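(* Let $F$ be a probability distribution function on $\mathbb{R}$ with finite mean $\mu$, and let $\tilde F$ be its residual distribution. Then there exist random variables $X_i\sim F$, $i\in\mathbb{N}$, and a random variable $Z\sim\tilde F$ such that for each $n\in\mathbb{N}$, with $S_n=X_1+\cdots+X_n$, $$|S_n-n\mu|\le Z.$$
   Context: All random variables are defined on a common atomless probability space $(\Omega,\mathcal A,\mathbb P)$, on which independent random vectors with any distributions can be generated; inequalities between random variables are understood almost surely. $X\sim F$ means that $X$ has distribution function $F$. Generalized inverse: $F^{-1}(t)=\inf\{x:F(x)\ge t\}$ for $t\in(0,1]$ and $F^{-1}(0)=\inf\{x:F(x)>0\}$. Residual distribution $\tilde F$ of a distribution $F$ with finite mean $\mu$: let $H(s)=\int_0^s (F^{-1}(t)-\mu)\,dt$ for $s\in[0,1]$, $\nu=F(\mu-)$ (left limit), $\nu^+=F(\mu)$. The function $H$ is strictly decreasing on $[0,\nu]$, strictly increasing on $[\nu^+,1]$, $H(0)=H(1)=0$, and its minimum is $c:=H(\nu)=H(\nu^+)$. For $s\in(c,0]$ let $A(s)\in[0,\nu)$ and $B(s)\in(\nu^+,1]$ be the points with $H(A(s))=s$ and $H(B(s))=s$; let $A(c)=B(c)=\nu^+$. Let $K(s)=1$ for $s>0$, $K(s)=B(s)-A(s)$ for $c<s\le 0$, $K(c)=\nu^+-\nu$, and $K(s)=0$ for $s<c$; $K$ is a distribution function on $[c,0]$. The residual distribution $\tilde F$ is the distribution of the random variable $F^{-1}(B(Y))-F^{-1}(A(Y))$, where $Y\sim K$. *)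

(* Defs.v *)
From HB Require Import structures.
From mathcomp Require Import all_boot all_order all_algebra.
From mathcomp Require Import all_classical all_reals all_analysis.
From mathcomp Require Import measurable_realfun.

Set Implicit Arguments.
Unset Strict Implicit.
Unset Printing Implicit Defensive.

Import Order.TTheory GRing.Theory Num.Theory.
Import numFieldNormedType.Exports.

Local Open Scope classical_set_scope.
Local Open Scope ring_scope.

Definition atomless d (T : measurableType d) (R : realType)
    (P : probability T R) : Prop :=
  forall A : set T, measurable A -> (0 < P A)%E ->
    exists B : set T, [/\ measurable B, B `<=` A & (0 < P B < P A)%E].

(* A distribution function on the line is a term of type
   cumulativeBounded 0 1: nondecreasing, right-continuous, with limits 0 at
   -oo and 1 at +oo. Its law is lebesgue_stieltjes_measure F. *)

Definition finite_mean (R : realType) (F : cumulativeBounded (0 : R) (1 : R))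
    : Prop :=
  (lebesgue_stieltjes_measure F).-integrable setT (fun x : R => x%:E).

Definition mean (R : realType) (F : cumulativeBounded (0 : R) (1 : R)) : R :=
  fine (\int[lebesgue_stieltjes_measure F]_x (x%:E)).

(* The value is an extended real: quantile F 0 can be -oo and quantile F 1 can
   be +oo. Only the values at t in [0, 1] are meaningful. *)
Definition quantile (R : realType) (F : cumulativeBounded (0 : R) (1 : R))
    (t : R) : \bar R :=
  if t == 0 then ereal_inf [set x%:E | x in [set x : R | 0 < F x]]
  else ereal_inf [set x%:E | x in [set x : R | t <= F x]].

Section Residual.
Context (R : realType) (F : cumulativeBounded (0 : R) (1 : R)).

Definition res_H (s : R) : R :=
  fine (\int[lebesgue_measure]_(t in `[0, s]) (quantile F t - (mean F)%:E)).

Definition res_nu : R := lim (F x @[x --> (mean F)^'-]).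

Definition res_nup : R := F (mean F).

Definition res_c : R := res_H res_nu.

(* For c < s <= 0 the point picked by xget exists and is unique when F has a
   finite mean, by strict monotonicity and continuity of res_H. The value
   nu^+ is prescribed at s = c; off [c, 0] it is a dummy value. *)
Definition res_A (s : R) : R :=
  if res_c < s <= 0 then xget 0 [set a | 0 <= a < res_nu /\ res_H a = s]
  else res_nup.

Definition res_B (s : R) : R :=
  if res_c < s <= 0 then xget 0 [set b | res_nup < b <= 1 /\ res_H b = s]
  else res_nup.

Definition res_K (s : R) : R :=
  if 0 < s then 1
  else if res_c < s then res_B s - res_A s
  else if s == res_c then res_nup - res_nu
  else 0.

Definition res_width (s : R) : \bar R :=
  (quantile F (res_B s) - quantile F (res_A s))%E.

(* G is the distribution function of the residual distribution of F: the law of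
   res_width (Y) for Y distributed according to res_K. The values of G are in
   \bar R to match the library's cdf. *)
Definition residual_distribution d (T : measurableType d)
    (P : probability T R) (G : R -> \bar R) : Prop :=
  exists Y : {RV P >-> R},
    [/\ forall s, cdf Y s = (res_K s)%:E,
        measurable_fun [set: T] (res_width \o Y : T -> \bar R) &
        forall x, G x = P [set w | (res_width (Y w) <= x%:E)%E]].

End Residual.

(* Main.v *)
Require Import Defs.
From HB Require Import structures.
From mathcomp Require Import all_boot all_order all_algebra.
From mathcomp Require Import all_classical all_reals all_analysis.
From mathcomp Require Import measurable_realfun zify ring lra.

(* Let V and W be independent and uniform on [0, 1], q the quantile function of
   F, m its mean and H(s) the integral of q - m over [0, s]. Then Y := H(V) has
   distribution function K, and given Y = s the value q(V) is one of
   a := q(A(s)) <= m <= b := q(B(s)), with mean m: the densities m - q to the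
   left of nu and q - m to the right of nu^+ are both pushed forward by H to
   Lebesgue measure on [c, 0]. So, given Y, a two-point variable that takes the
   value b with probability p := (m - a) / (b - a) and the value a otherwise
   mixes over Y to the law F. Put X_i := b if W + i p and W + (i + 1) p have
   different floors, and X_i := a otherwise. The number of b's among the first n
   terms is floor(W + n p) - floor(W), which differs from n p by at most 1, hence
   |S_n - n m| <= b - a, and b - a is the residual width at Y. *)

Set Implicit Arguments.
Unset Strict Implicit.
Unset Printing Implicit Defensive.

Import Order.TTheory GRing.Theory Num.Theory.
Import numFieldNormedType.Exports.

Local Open Scope classical_set_scope.
Local Open Scope ring_scope.

(** * Measure-theoretic preliminaries *)

(** Why the two-point variable mixes to F, without conditional distributions: fix x and compare its
    conditional distribution function at x, taken at level H(v), with the indicator of q(v) <= x.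
    Left of nu one has q(v) = a and p = (m - q(v)) / (b - a); right of nu^+ one has q(v) = b and 1 -
    p = (q(v) - m) / (b - a). In both cases the difference is (m - q(v)) g(H(v)), where g = (1{b <=
    x} - 1{a <= x}) / (b - a) depends on the level only. Since q - m is the derivative of H, the
    integral of (q - m) g(H) is that of g along a path that starts at H(0) = 0 and returns to H(1) =
    0, hence it vanishes. The functions involved are too rough for a substitution rule, so this is
    proved on sublevel sets of H and extended by uniqueness of measures. Two obstacles shape the
    rest. The quantile function can be infinite at 0 and 1, so real-valued work stays on the open
    interval. The space is only assumed atomless, so V and W must be constructed: one uniform
    variable comes from a maximal chain of events, and its base-4 digits are dealt out to two
    variables. *)

Lemma measure_eq_rays (R : realType)
    (m1 m2 : {measure set (measurableTypeR R) -> \bar R}) :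
  (m1 setT < +oo)%E ->
  (forall x : R, m1 `]-oo, x]%classic = m2 `]-oo, x]%classic) ->
  forall A, measurable A -> m1 A = m2 A.
Proof.
move=> m1oo m12.
have m1fin (A : set (measurableTypeR R)) : measurable A -> (m1 A < +oo)%E.
  by move=> mA; apply: le_lt_trans m1oo; apply: le_measure; rewrite ?inE.
(* Finite mass makes a half-open interval a difference of rays; such intervals form a generating
   class stable under intersection. *)
have oc (m : {measure set (measurableTypeR R) -> \bar R}) (a b : R) : a <= b ->
    (m `]-oo, a]%classic < +oo)%E ->
    m `]a, b]%classic = (m `]-oo, b]%classic - m `]-oo, a]%classic)%E.
  move=> ab ma.
  rewrite (@itv_bndbnd_setU _ _ -oo%O (BRight a) (BRight b)) ?bnd_simp//.
  rewrite measureU//; last first.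
    apply/seteqP; split => // x []/=; rewrite !in_itv/= => xa /andP[ax _].
    by move: (le_lt_trans xa ax); rewrite ltxx.
  rewrite [X in (X - _)%E]addeC addeK//.
  by rewrite ge0_fin_numE.
apply: (@measure_unique _ R (measurableTypeR R) (@ocitv R) (fun n => `](- n%:R), n%:R]%classic)).
- by [].
- exact: ocitvI.
- by move=> i; exists (- i%:R, i%:R).
- exact: (bigcup_itvT false false).
- move=> _ [[a b] _ <-].
  have [ab|ba] := leP a b; last by rewrite set_itv_ge ?measure0// -leNgt bnd_simp ltW.
  by rewrite /= !oc// -?m12//; exact: m1fin.
- by move=> k; apply: m1fin.
Qed.

(** * Measures with a density *)

Section density.
Local Open Scope ereal_scope.
Context d (T : measurableType d) (R : realType).
Variables (mu : {measure set T -> \bar R}) (k : T -> R).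
Hypothesis mk : measurable_fun setT k.
Hypothesis k0 : forall x, (0 <= k x)%R.

(** Measurability and sign of [k] are carried as arguments so that the measure structure declared
    below can be found from the term [mdensity mk k0] alone. *)
Definition mdensity of measurable_fun setT k & (forall x, (0 <= k x)%R) :=
  fun E : set T => \int[mu]_(x in E) (k x)%:E.

Local Notation nu := (mdensity mk k0).

Let nu0 : nu set0 = 0. Proof. exact: integral_set0. Qed.

Let nu_ge0 E : 0 <= nu E. Proof. by apply: integral_ge0 => x _; rewrite lee_fin. Qed.

Let nu_sigma_additive : semi_sigma_additive nu.
Proof.
move=> F mF tF mUF; rewrite /mdensity; apply: cvg_toP.
  apply: ereal_nondecreasing_is_cvgn => m n mn.
  apply: lee_sum_nneg_natr => // i _ _; exact: nu_ge0.
rewrite ge0_integral_bigcup//=; last by move=> x _; rewrite lee_fin.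
exact/measurable_EFinP/measurable_funTS.
Qed.

HB.instance Definition _ := isMeasure.Build _ _ _ nu
  nu0 nu_ge0 nu_sigma_additive.

Import HBNNSimple.

Let integral_mdensity_nnsfun (f : {nnsfun T >-> R}) :
  \int[nu]_x (f x)%:E = \int[mu]_x ((f x)%:E * (k x)%:E).
Proof.
under [LHS]eq_integral do rewrite fimfunE -fsumEFin//.
rewrite [LHS]ge0_integral_fsum//; last 2 first.
  - by move=> r; exact/measurable_EFinP/measurableT_comp.
  - by move=> n x _; rewrite EFinM nnfun_muleindic_ge0.
under [RHS]eq_integral.
  move=> x xD; rewrite fimfunE -fsumEFin// ge0_mule_fsuml; last first.
    by move=> r; rewrite EFinM nnfun_muleindic_ge0.
  over.
rewrite [RHS]ge0_integral_fsum//; last 2 first.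
  - move=> r; apply: emeasurable_funM; last exact/measurable_EFinP.
    by apply/measurable_EFinP; do 2 apply/measurableT_comp => //.
  - move=> n x _; rewrite mule_ge0 ?lee_fin// -lee_fin EFinM.
    exact: nnfun_muleindic_ge0.
apply: eq_fsbigr => r; rewrite inE => -[x _ <-].
rewrite integralZl_indic_nnsfun//= integral_indic//= setIT.
under [RHS]eq_integral do rewrite EFinM -muleA.
rewrite [RHS]ge0_integralZl//; last 3 first.
  - by apply: emeasurable_funM => //; apply/measurable_EFinP => //; exact: measurable_indic.
  - by move=> y _; rewrite mule_ge0// lee_fin//.
  - by rewrite lee_fin.
congr (_ * _); rewrite /mdensity integral_mkcond.
by apply: eq_integral => y _; rewrite epatch_indic muleC.
Qed.

Lemma ge0_integral_mdensity (f : T -> \bar R) :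
  measurable_fun setT f -> (forall x, 0 <= f x) ->
  \int[mdensity mk k0]_x f x = \int[mu]_x (f x * (k x)%:E).
Proof.
move=> mf f0.
pose f_ := nnsfun_approx measurableT mf.
have fE x : lim (EFin (f_ n x) @[n --> \oo]) = f x.
  by apply/cvg_lim => //; exact: cvg_nnsfun_approx.
transitivity (lim (\int[nu]_x (f_ n x)%:E @[n --> \oo])).
  rewrite -monotone_convergence//=.
  - by apply: eq_integral => x _; rewrite fE.
  - by move=> n; exact/measurable_EFinP.
  - by move=> n x _; rewrite lee_fin.
  - by move=> x _ m n mn; rewrite lee_fin; exact/lefP/nd_nnsfun_approx.
transitivity (lim (\int[mu]_x ((f_ n x)%:E * (k x)%:E) @[n --> \oo])).
  by under eq_fun do rewrite integral_mdensity_nnsfun.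
rewrite -monotone_convergence//=.
- apply: eq_integral => x _; apply/cvg_lim => //; apply: cvgeZr => //.
  exact: cvg_nnsfun_approx.
- by move=> n; apply: emeasurable_funM; exact/measurable_EFinP.
- by move=> n x _; rewrite mule_ge0// lee_fin//.
- move=> x _ m n mn; rewrite lee_wpmul2r ?lee_fin//.
  exact/lefP/nd_nnsfun_approx.
Qed.

End density.

(** * A uniform variable on an atomless space *)

Section maximal_graded_family.
Context d (T : measurableType d) (R : realType) (P : probability T R).
Implicit Types (A B : set T) (D : set (set T)).

(* A maximal graded family takes every value in [0, 1]: a gap of values could be
   filled using atomlessness. It then plays the role of the sets {V <= t}. *)
Definition graded D :=
  D `<=` measurable /\ forall A B, D A -> D B -> (P A <= P B)%E -> A `<=` B.

(** For a measurable [B], this is what adding [B] to a graded family requires; maximality is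
    therefore stated through it. *)
Definition graded_compatible D B := forall A, D A ->
  ((P A <= P B)%E -> A `<=` B) /\ ((P B <= P A)%E -> B `<=` A).

Definition maximal_graded D := graded D /\
  forall B, measurable B -> graded_compatible D B -> D B.

Lemma maximal_graded_exists : exists D, maximal_graded D.
Proof.
have [F Fgr Ftot|D [gD maxD]] := @Zorn_bigcup (set T) graded.
  split=> [A [D FD DA]|A B [D1 FD1 D1A] [D2 FD2 D2B] AB].
    exact: (Fgr _ FD).1 _ DA.
  have [D12|D21] := Ftot _ _ FD1 FD2.
    exact: (Fgr _ FD2).2 _ _ (D12 _ D1A) D2B AB.
  exact: (Fgr _ FD1).2 _ _ D1A (D21 _ D2B) AB.
exists D; split=> // B mB cB; apply: contrapT => nDB.
apply: (maxD (D `|` [set B])).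
  by split; [left|move=> sub; apply: nDB; apply: sub; right].
split=> [A [DA|->//]|A A' [DA|->] [DA'|->]//].
- exact: gD.1.
- exact: gD.2.
- by move=> ?; apply: (cB _ DA).1.
- by move=> ?; apply: (cB _ DA').2.
- by move=> _ x.
Qed.

(** This duality yields the least member above [t] from the greatest member below [1 - t]. *)
Lemma maximal_gradedC D : maximal_graded D -> maximal_graded [set ~` A | A in D].
Proof.
move=> [[mD gD] maxD].
have PC A B : measurable A -> measurable B ->
    (P (~` A) <= P (~` B))%E = (P B <= P A)%E.
  move=> mA mB; rewrite !probability_setC//.
  rewrite -[P A]fineK ?fin_num_measure// -[P B]fineK ?fin_num_measure//.
  by rewrite -!EFinB !lee_fin lerD2l lerN2.
split; first split.
- by move=> _ [A DA <-]; apply: measurableC; exact: mD.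
- move=> _ _ [A DA <-] [B DB <-]; rewrite PC; [|exact: mD..] => BA.
  by apply: subsetC; exact: gD.
- move=> B mB cB; exists (~` B); last by rewrite setCK.
  apply: maxD => [|A DA]; first exact: measurableC.
  have mA := mD _ DA.
  have [c1 c2] := cB (~` A) (ex_intro2 _ _ A DA erefl).
  rewrite -(setCK A) !PC//; last 2 first.
    exact: measurableC.
    exact: measurableC.
  by split=> PAB; apply: subsetC; [exact: c2|exact: c1].
Qed.

(** If no member attains the supremum of the values up to [t], the union of countably many members
    approaching it is comparable with every member, so maximality puts it in [D]. *)
Lemma maximal_graded_below D (t : R) : maximal_graded D -> 0 <= t ->
  exists L, [/\ D L, (P L <= t%:E)%E &
    forall A, D A -> (P A <= t%:E)%E -> (P A <= P L)%E].
Proof.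
move=> [[mD gD] maxD] t0.
pose p A := fine (P A).
have pE A : D A -> P A = (p A)%:E.
  by move=> DA; rewrite fineK// fin_num_measure//; exact: mD.
pose S := [set p A | A in [set A | D A /\ p A <= t]].
have S0 : S !=set0.
  (* Were all values above [t], the empty set would be compatible with [D] and so belong to it, with
     value 0. *)
  apply: contrapT => S0; have D0 : D set0.
    apply: maxD => // A DA; rewrite measure0 pE// !lee_fin; split=> [pA|_ x //].
    by case: S0; exists (p A), A => //; split => //; exact: le_trans t0.
  by apply: S0; exists (p set0), set0 => //; split; rewrite // /p measure0.
have Sub : has_sup S by split => //; exists t => _ [A [_ ?] <-].
have [[L [DL Lt supL]]|nattained] :=
    pselect (exists L, [/\ D L, p L <= t & p L = sup S]).
  exists L; split=> [//||A DA]; rewrite !pE// !lee_fin// => At.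
  by rewrite supL; apply: (sup_upper_bound Sub); exists A.
have /choice[C HC] : forall n : nat, exists C, [/\ D C, p C <= t &
    sup S - n.+1%:R^-1 < p C].
  move=> n; have /(sup_adherent (eps := n.+1%:R^-1)) : 0 < n.+1%:R^-1 :> R by [].
  by move=> /(_ _ Sub)[_ [A [DA At] <-] ?]; exists A.
have DC n : D (C n) by have [] := HC n.
have mC n : measurable (C n) by exact: mD.
pose U n := \bigcup_(k < n.+1) C k.
(* Members of [D] are nested, so a finite union of them is again one of them. *)
have DU n : D (U n) /\ p (U n) <= t.
  elim: n => [|n [DUn Unt]].
    rewrite /U (_ : \bigcup_(k < 1) C k = C 0%N); first by have [] := HC 0%N.
    by apply/seteqP; split=> [x [[|//] _]//|x Cx]; exists 0%N.
  have -> : U n.+1 = U n `|` C n.+1.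
    apply/seteqP; split=> [x [k /= + Ckx]|x [[k /= kn Ckx]|Cx]].
    - by rewrite ltnS leq_eqVlt => /predU1P[<-|kn]; [right|left; exists k].
    - by exists k => //=; rewrite ltnW.
    - by exists n.+1 => /=.
  have [UC|/ltW CU] := leP (p (U n)) (p (C n.+1)).
    rewrite setUidr; first by have [] := HC n.+1.
    by apply: gD => //; rewrite !pE// lee_fin.
  rewrite setUidl//; apply: gD => //; by rewrite !pE// lee_fin.
pose L := \bigcup_n U n.
have mU n : measurable (U n) by apply: mD; exact: (DU n).1.
have mL : measurable L by exact: bigcup_measurable.
have PL : (P L <= (sup S)%:E)%E.
  have cvU : P (U n) @[n --> \oo] --> P L.
    apply: nondecreasing_cvg_mu => // m n mn; apply/subsetPset => x [k /= km Ckx].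
    by exists k => //=; exact: leq_trans km _.
  rewrite -(cvg_lim _ cvU)//; apply: lime_le; first by apply/cvg_ex; exists (P L).
  apply: nearW => n; rewrite pE ?lee_fin; last exact: (DU n).1.
  by apply: (sup_upper_bound Sub); exists (U n).
have CL n : C n `<=` L by move=> x Cx; exists n => //; exists n => /=.
have PCL n : (P (C n) <= P L)%E by apply: le_measure; rewrite ?inE.
have ltC A : D A -> p A <= t -> exists n, p A < p (C n).
  move=> DA At; have pAs : p A < sup S.
    rewrite lt_neqAle; apply/andP; split.
      by apply/eqP => pAs; apply: nattained; exists A.
    by apply: (sup_upper_bound Sub); exists A.
  have [n pn] : exists n : nat, n.+1%:R^-1 < sup S - p A.
    have d0 : 0 < sup S - p A by rewrite subr_gt0.
    exists (Num.truncn (sup S - p A)^-1).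
    by rewrite invf_plt ?posrE// truncnS_gt.
  exists n; have [_ _] := HC n; apply: lt_trans.
  by rewrite ltrBrDr addrC -ltrBrDr.
have supt : sup S <= t by apply: ge_sup => // _ [A [_ ?] <-].
(* A member with value at most [P L] stays below the supremum, so it sits inside some [C n]; a
   member with value at least [P L] contains every [C n]. *)
exists L; split.
- apply: maxD => // A DA; split=> [PAL|PLA].
    have [|n pn] := ltC A DA.
      by rewrite -lee_fin -pE// (le_trans PAL)// (le_trans PL)// lee_fin.
    by apply: subset_trans (CL n); apply: gD => //; rewrite !pE// lee_fin ltW.
  move=> x [n _ [k _ Ckx]]; apply: (gD (C k)) => //.
  exact: le_trans (PCL k) PLA.
- by rewrite (le_trans PL)// lee_fin.
- move=> A DA; rewrite pE// lee_fin => At; have [n pn] := ltC A DA At.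
  by rewrite (le_trans _ (PCL n))// pE// lee_fin ltW.
Qed.

End maximal_graded_family.

Section uniform_of_atomless.
Context d (T : measurableType d) (R : realType) (P : probability T R).

Lemma maximal_graded_above (D : set (set T)) (t : R) : maximal_graded P D ->
  t <= 1 -> exists U, [/\ D U, (t%:E <= P U)%E &
    forall A, D A -> (t%:E <= P A)%E -> (P U <= P A)%E].
Proof.
move=> gD t1; have mD := gD.1.1.
have [|L [[U DU <-] Ut maxU]] :=
    maximal_graded_below (t := 1 - t) (maximal_gradedC gD).
  by rewrite subr_ge0.
have subC (x : R) A : measurable A -> (P (~` A) <= (1 - x)%:E)%E = (x%:E <= P A)%E.
  move=> mA; rewrite probability_setC// -[P A]fineK ?fin_num_measure//.
  by rewrite -EFinB !lee_fin lerD2l lerN2.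
exists U; split => //; first by rewrite -subC//; exact: mD.
move=> A DA; rewrite -subC; last exact: mD.
move=> /(maxU _ (ex_intro2 _ _ A DA erefl)).
rewrite [X in (_ <= X)%E]probability_setC; last exact: mD.
rewrite -[P U]fineK ?fin_num_measure//; last exact: mD.
by rewrite -EFinB subC//; exact: mD.
Qed.

Lemma maximal_graded_value (D : set (set T)) (t : R) : atomless P ->
  maximal_graded P D -> 0 <= t <= 1 -> exists2 A, D A & P A = t%:E.
Proof.
move=> aP gD /andP[t0 t1]; have [[mD grD] maxD] := gD.
have [L [DL Lt maxL]] := maximal_graded_below gD t0.
have [U [DU tU minU]] := maximal_graded_above gD t1.
move: Lt; rewrite le_eqVlt => /predU1P[?|Lt]; first by exists L.
move: tU; rewrite le_eqVlt => /predU1P[?|tU]; first by exists U.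
have mL := mD _ DL; have mU := mD _ DU.
have LU : L `<=` U by apply: grD => //; exact/ltW/(lt_trans Lt).
have PUL : P (U `\` L) = (P U - P L)%E.
  by rewrite measureD ?setIidr// -ge0_fin_numE// fin_num_measure.
have [|B [mB BUL /andP[B0 BltUL]]] := aP (U `\` L) (measurableD mU mL).
  by rewrite PUL sube_gt0 (lt_trans Lt).
(* In measure [M] lies strictly between [L] and [U], where no member of [D] lies. Hence it is
   compatible with [D] and belongs to it, against the extremality of [L] or of [U]. *)
pose M := L `|` B.
have mM : measurable M by exact: measurableU.
have MU : M `<=` U by move=> x [/LU//|/BUL[]].
have PM : P M = (P L + P B)%E.
  by rewrite measureU//; apply/seteqP; split=> // x [Lx /BUL[]].
have LM : (P L < P M)%E.
  by rewrite PM lteDl// fin_num_measure.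
have MU' : (P M < P U)%E.
  by rewrite PM addeC -lteBrDr ?fin_num_measure// -PUL.
have DM : D M.
  apply: maxD => // A DA; have [At|tA] := leP (P A) t%:E.
    have AL := maxL A DA At; split=> [_|MA].
      by move=> x Ax; left; move: x Ax; exact: grD.
    by move: (lt_le_trans LM (le_trans MA AL)); rewrite ltxx.
  have UA := minU A DA (ltW tA); split=> [AM|_].
    by move: (lt_le_trans MU' (le_trans UA AM)); rewrite ltxx.
  exact: subset_trans MU (grD _ _ DU DA UA).
have [Mt|tM] := leP (P M) t%:E.
  by move: (lt_le_trans LM (maxL M DM Mt)); rewrite ltxx.
by move: (lt_le_trans MU' (minU M DM (ltW tM))); rewrite ltxx.
Qed.

Lemma atomless_uniform : atomless P -> exists V : {RV P >-> R},
  (forall w, 0 <= V w <= 1) /\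
  forall t, 0 <= t <= 1 -> P [set w | V w <= t] = t%:E.
Proof.
move=> aP; have [D gD] := maximal_graded_exists P; have [[mD grD] _] := gD.
have /choice[C HC] (t : R) : exists A, 0 <= t <= 1 -> D A /\ P A = t%:E.
  have [t01|?] := boolP (0 <= t <= 1); last by exists set0.
  by have [A ? ?] := maximal_graded_value aP gD t01; exists A.
have mC t : 0 <= t <= 1 -> measurable (C t) by move=> /HC[/mD].
have CC s t : 0 <= s <= 1 -> 0 <= t <= 1 -> s <= t -> C s `<=` C t.
  by move=> /HC[Ds Ps] /HC[Dt Pt] st; apply: grD => //; rewrite Ps Pt lee_fin.
(* The element 1 keeps this set nonempty for every [w], so that its infimum is meaningful. *)
pose S w := [set t | t = 1 \/ 0 <= t <= 1 /\ C t w].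
have S0 w : S w !=set0 by exists 1; left.
have lbS w : lbound (S w) 0 by move=> t [->//|[/andP[]]].
have infS w : has_inf (S w) by split => //; exists 0.
pose V w := inf (S w).
have V01 w : 0 <= V w <= 1.
  by rewrite lb_le_inf//= ge_inf//; [exists 0|left].
(* Rational indices suffice because [C] is increasing; the union becomes countable and [V]
   measurable. *)
have VltE t : t <= 1 ->
    [set w | V w < t] = \bigcup_(q in [set q : rat | 0 <= (ratr q : R) <= 1 /\ ratr q < t]) C (ratr q).
  move=> t1; apply/seteqP; split=> [w /= Vt|w [q [q01 qt] Cq] /=]; last first.
    by apply: le_lt_trans qt; apply: ge_inf; [exists 0|right].
  have [|r] := inf_adherent (eps := t - V w) _ (infS w).
    by rewrite subr_gt0.
  rewrite addrC subrK => -[->|[r01 Cr] rt]; first by rewrite ltNge t1.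
  have [q /andP[rq qt]] := rat_in_itvoo rt.
  have q01 : 0 <= (ratr q : R) <= 1.
    by rewrite (le_trans (andP r01).1 (ltW rq)) (le_trans (ltW qt)).
  by exists q => //; apply: CC Cr => //; exact: ltW.
have mV : measurable_fun setT V.
  apply: (measurability _ (RGenInftyO.measurableE R)) => _ [_ [t ->] <-].
  rewrite setTI (_ : _ @^-1` _ = [set w | V w < t]); last first.
    by apply/seteqP; split=> w /=; rewrite in_itv.
  have [t1|t1] := leP t 1.
    rewrite VltE// bigcup_mkcond; apply: bigcupT_measurable_rat => q.
    by case: ifPn => [/set_mem[q01 _]|_ //]; exact: mC.
  rewrite (_ : [set _ | _] = setT)//; apply/seteqP; split=> // w _ /=.
  by apply: le_lt_trans t1; case/andP: (V01 w).
pose V_ : {RV P >-> R} := HB.pack V (isMeasurableFun.Build _ _ _ _ V mV).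
exists V_; split => //= t t01.
have mVt s : measurable [set w | V w <= s].
  rewrite (_ : [set _ | _] = V @^-1` `]-oo, s]) -1?[X in measurable X]setTI; first by apply: (mV).
  by apply/seteqP; split=> w /=; rewrite in_itv.
apply/eqP; rewrite eq_le; apply/andP; split; last first.
  have [_ <-] := HC _ t01; apply: le_measure; rewrite ?inE//; first exact: mC.
  by move=> w Cw /=; apply: ge_inf; [exists 0|right].
(* The infimum need not be attained, so {V <= t} is only enclosed in [C (t + e)], of probability
   [t + e]. *)
apply/lee_addgt0Pr => e e0; have [t1e|te1] := leP 1 (t + e).
  by rewrite (le_trans (probability_le1 _ _))// -EFinD lee_fin.
have te01 : 0 <= t + e <= 1.
  by rewrite (ltW te1) addr_ge0//; [case/andP: t01|exact: ltW].
rewrite -EFinD; have [_ <-] := HC _ te01.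
apply: le_measure; rewrite ?inE//; first exact: mC.
move=> w /= Vt; have [|r] := inf_adherent (eps := e) _ (infS w) => //.
move=> [->|[r01 Cr] rV]; last first.
  by apply: CC Cr => //; rewrite ltW// (lt_le_trans rV)// lerD2r.
by move=> oV; move: (lt_le_trans oV (lerD Vt (lexx e))); rewrite ltNge (ltW te1).
Qed.

End uniform_of_atomless.

(** * Splitting a uniform variable into two independent ones *)

Section base4_digits.

(* The base-4 digits 2 d + d' of a (n of them) yield two binary numbers, one with
   the digits d and the other with the digits d'. *)
Fixpoint even_digits (n a : nat) : nat :=
  if n is m.+1 then (2 * even_digits m (a %/ 4) + (a %% 4) %/ 2)%N else 0%N.

Fixpoint odd_digits (n a : nat) : nat :=
  if n is m.+1 then (2 * odd_digits m (a %/ 4) + a %% 2)%N else 0%N.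

Fixpoint interleave (n k l : nat) : nat :=
  if n is m.+1
  then (4 * interleave m (k %/ 2) (l %/ 2) + 2 * (k %% 2) + l %% 2)%N else 0%N.

Lemma even_digits_lt n a : (even_digits n a < 2 ^ n)%N.
Proof.
by elim: n a => [//|n IH] a /=; have := IH (a %/ 4)%N; rewrite expnS; lia.
Qed.

Lemma odd_digits_lt n a : (odd_digits n a < 2 ^ n)%N.
Proof.
by elim: n a => [//|n IH] a /=; have := IH (a %/ 4)%N; rewrite expnS; lia.
Qed.

Lemma interleave_lt n k l : (interleave n k l < 4 ^ n)%N.
Proof.
by elim: n k l => [//|n IH] k l /=; have := IH (k %/ 2)%N (l %/ 2)%N; rewrite expnS; lia.
Qed.

Lemma interleaveP n k l a : (k < 2 ^ n)%N -> (l < 2 ^ n)%N -> (a < 4 ^ n)%N ->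
  (even_digits n a = k /\ odd_digits n a = l) <-> a = interleave n k l.
Proof.
elim: n k l a => [|n IH] k l a /=; first by rewrite !expn0; lia.
rewrite !expnS => k2 l2 a4; have := IH (k %/ 2)%N (l %/ 2)%N (a %/ 4)%N.
move: (even_digits n _) (odd_digits n _) (interleave n _ _) => e o i.
by lia.
Qed.

End base4_digits.

(** * The uniform law on the unit interval *)

Section uniform01.
Context (R : realType).
Notation U01 := (uniform_prob (@ltr01 R)).
Notation mu := (@lebesgue_measure R).

Lemma uniform01E A : measurable A -> U01 A = mu (A `&` `[0, 1]).
Proof.
move=> mA; rewrite /uniform_prob integral_uniform_pdf.
rewrite (eq_integral (cst 1%E)) ?integral_cst ?mul1e//; first exact: measurableI.
move=> x; rewrite inE /= => -[_]; rewrite in_itv/= /uniform_pdf => ->.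
by rewrite subr0 invr1.
Qed.

Lemma uniform01_oo A : measurable A -> U01 A = mu (A `&` `]0, 1[).
Proof.
move=> mA; rewrite uniform01E//; apply/eqP; rewrite eq_le; apply/andP; split.
  apply: (@le_trans _ _ (mu ((A `&` `]0, 1[) `|` ([set 0] `|` [set 1])))).
    apply: le_measure; rewrite ?inE.
    - exact: measurableI.
    - by apply: measurableU; [exact: measurableI|exact: measurableU].
    - move=> x [Ax]; rewrite /= !in_itv/= => /andP[].
      rewrite le_eqVlt => /predU1P[<- _|x0]; first by right; left.
      rewrite le_eqVlt => /predU1P[->|x1]; first by right; right.
      by left; rewrite x0 x1.
  apply: le_trans (measureU2 _ _ _) _ => //.
  - exact: measurableI.
  - exact: measurableU.
  rewrite /= -[leRHS]adde0 leeD2l//.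
  apply: le_trans (measureU2 _ _ _) _ => //.
  by rewrite /= !lebesgue_measure_set1 adde0.
apply: le_measure; rewrite ?inE; [exact: measurableI|exact: measurableI|].
by apply: setIS; apply: subset_itv; rewrite bnd_simp.
Qed.

(** Discards the point 1, whose truncation at depth [n] is [4 ^ n] and falls outside the grid of
    digits. *)
Lemma uniform01_le_co A : measurable A -> (U01 A <= U01 (A `&` `[0%R, 1%R[))%E.
Proof.
move=> mA; have mA1 : measurable (A `&` `[0%R, 1%R[) by exact: measurableI.
rewrite !uniform01_oo//.
apply: le_measure; rewrite ?inE; [exact: measurableI|exact: measurableI|].
move=> x [Ax x01]; do 2 split => //; move: x01; rewrite /= !in_itv/=.
by move=> /andP[/ltW-> ->].
Qed.

Lemma uniform01_itv (i : interval R) (a b : R) (b0 b1 : bool) :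
  i = Interval (BSide b0 a) (BSide b1 b) ->
  0 <= a -> a <= b -> b <= 1 -> U01 [set` i] = (b - a)%:E.
Proof.
move=> -> a0 ab b1'; rewrite uniform01E// setIidl; last first.
  move=> x /=; rewrite !in_itv/=.
  by case: b0; case: b1 => /= /andP[? ?]; apply/andP; split; lra.
rewrite lebesgue_measure_itv/= lte_fin; case: ltP => [|ba]; first by rewrite EFinB.
by rewrite (_ : a = b) ?subrr//; apply/le_anti; rewrite ab ba.
Qed.

Lemma uniform01_ray (t : R) : 0 <= t <= 1 -> U01 `]-oo, t] = t%:E.
Proof.
move=> /andP[t0 t1]; rewrite uniform01E//.
have -> : `]-oo, t] `&` `[0, 1] = `[0, t]%classic :> set R.
  apply/seteqP; split=> x /=; rewrite !in_itv/=.
    by move=> [-> /andP[->]].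
  by move=> /andP[-> xt]; rewrite xt (le_trans xt).
by rewrite lebesgue_measure_itv/= lte_fin sube0; case: ltP => // ?;
  congr EFin; apply/le_anti/andP.
Qed.

End uniform01.

(** The event [L] and the factor [c] allow an independence statement to be extended from rays to
    Borel sets one coordinate at a time: [L] is the event on the other coordinate and [c] its
    probability. *)
Lemma measure_preimage_eq_rays d (T : measurableType d) (R : realType)
    (m : {measure set T -> \bar R}) (Q : {measure set (measurableTypeR R) -> \bar R})
    (X : T -> R) (L : set T) (c : R) :
  measurable_fun setT X -> measurable L -> (m L < +oo)%E -> 0 <= c ->
  (forall x : R, m (X @^-1` `]-oo, x] `&` L) = (c%:E * Q `]-oo, x]%classic)%E) ->
  forall A : set R, measurable A -> m (X @^-1` A `&` L) = (c%:E * Q A)%E.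
Proof.
move=> mX mL Loo c0 rays A mA.
have mX' : measurable_fun setT (X : T -> measurableTypeR R) by [].
(* The structure is given by its full name because the measurability of X is an
   argument that cannot be inferred. *)
pose m1 : {measure set (measurableTypeR R) -> \bar R} :=
  measure_function_pushforward__canonical__measure_function_Measure (mrestr m mL) mX'.
pose m2 : {measure set (measurableTypeR R) -> \bar R} := mscale (NngNum c0) Q.
apply: (@measure_eq_rays R m1 m2) => //.
by rewrite /m1 /= /pushforward preimage_setT /mrestr setTI.
Qed.

(** With [u n] read as the first [n] binary digits, the intervals from u n / 2^n to (u n + 1) / 2^n
    are nested. The number is taken as [sups _ 0], the supremum of the whole sequence, whose
    measurability in a parameter needs no convergence. *)
Lemma sup_binary_expansion (R : realType) (u : nat -> nat) :
  (forall n, (u n < 2 ^ n)%N) ->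
  (forall n, exists2 b : nat, (b < 2)%N & u n.+1 = (2 * u n + b)%N) ->
  forall n, (u n)%:R / 2 ^+ n <= sups (fun n => (u n)%:R / 2 ^+ n : R) 0 <=
            (u n).+1%:R / 2 ^+ n.
Proof.
move=> u2 uS n; set v := fun n => _.
have uD m k : (u m * 2 ^ k <= u (m + k) < (u m).+1 * 2 ^ k)%N.
  elim: k => [|k /andP[k1 k2]]; first by rewrite addn0 expn0; lia.
  by rewrite addnS expnS; have [b b2 ->] := uS (m + k)%N; lia.
have p0 m : 0 < 2 ^+ m :> R by rewrite exprn_gt0.
have vle m k : v m <= (u k).+1%:R / 2 ^+ k.
  rewrite ler_pdivrMr// mulrAC ler_pdivlMr// -!natrX -!natrM ler_nat.
  have [km|/ltnW mk] := leqP k m.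
    have /andP[_] := uD k (m - k)%N; rewrite subnKC// => h.
    by rewrite -{2}(subnKC km) expnD (mulnC (2 ^ k)%N) mulnA leq_mul// ltnW.
  have /andP[h _] := uD m (k - m)%N; rewrite subnKC// in h.
  rewrite -{1}(subnKC mk) expnD mulnCA mulnC leq_mul//.
  by rewrite (leq_trans h)// ltnW.
have Dv : sdrop v 0 !=set0 by exists (v 0%N), 0%N.
apply/andP; split.
  apply: ub_le_sup; last by exists n.
  by exists ((u n).+1%:R / 2 ^+ n) => _ [m _ <-].
by apply: ge_sup => // _ [m _ <-].
Qed.

Section digit_split.
Context (R : realType).
Notation U01 := (uniform_prob (@ltr01 R)).
Notation mu := (@lebesgue_measure R).
Implicit Types x t u : R.

(** For [x] in [0, 1), the integer written with the first [n] base-4 digits of [x]. *)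
Let a n x := Num.truncn (4 ^+ n * x).
Let e n x := even_digits n (a n x).
Let o n x := odd_digits n (a n x).

Let measurable_truncn : measurable_fun setT (@Num.truncn R).
Proof.
move=> _ Y _; rewrite setTI.
rewrite (_ : _ @^-1` _ = \bigcup_(n in Y) (@Num.truncn R @^-1` [set n])).
  apply: bigcup_measurable => n _; apply: is_interval_measurable => x y /= xn yn.
  move=> z /andP[xz zy]; apply/eqP; rewrite eqn_leq -{1}yn -{1}xn.
  by rewrite !le_truncn.
by apply/seteqP; split=> [x Yx|x [n Yn /= -> //]]; exists (Num.truncn x).
Qed.

Let measurable_comp_a n (f : nat -> nat) (g : nat -> R) :
  measurable_fun setT (fun x => g (f (a n x))).
Proof.
apply: (@measurableT_comp _ _ _ _ _ _ (g \o f)) => //.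
apply: (measurableT_comp measurable_truncn); exact: mulrl_measurable.
Qed.

Let a_div n x : (a n.+1 x %/ 4 = a n x)%N.
Proof.
rewrite /a exprS -mulrA; move: (4 ^+ n * x) => y.
have [y0|y0] := leP 0 y; last first.
  have tr0 (z : R) : z < 0 -> Num.truncn z = 0%N.
    by move=> ?; apply/truncn0Pn; rewrite -ltNge; lra.
  by rewrite !tr0//; lra.
have /andP[m1 m2] := truncn_itv y0.
have /andP[k1 k2] : (Num.truncn (4 * y))%:R <= 4 * y < (Num.truncn (4 * y)).+1%:R.
  by apply: truncn_itv; lra.
move: (Num.truncn y) (Num.truncn (4 * y)) m1 m2 k1 k2 => m k m1 m2 k1 k2.
have : k%:R < (4 * m.+1)%:R :> R by rewrite natrM; lra.
have : (4 * m)%:R < k.+1%:R :> R by rewrite natrM; lra.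
by rewrite !ltr_nat; lia.
Qed.

Let eS n x : exists2 b : nat, (b < 2)%N & e n.+1 x = (2 * e n x + b)%N.
Proof. by rewrite /e /= a_div; exists (a n.+1 x %% 4 %/ 2)%N => //; lia. Qed.

Let oS n x : exists2 b : nat, (b < 2)%N & o n.+1 x = (2 * o n x + b)%N.
Proof. by rewrite /o /= a_div; exists (a n.+1 x %% 2)%N => //; lia. Qed.

Let grid n k l : set R := [set x | [/\ 0 <= x < 1, (e n x < k)%N & (o n x < l)%N]].

Let measurable_ltn n (f : nat -> nat) k : measurable [set x | (f (a n x) < k)%N].
Proof.
have := @measurable_comp_a n f (fun i => (i < k)%:R) measurableT [set 1]
  (measurable_set1 _).
rewrite setTI; congr measurable; apply/seteqP; split=> x /=; case: ltnP => //.
by move=> _ /eqP; rewrite eq_sym oner_eq0.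
Qed.

Let measurable_grid n k l : measurable (grid n k l).
Proof.
rewrite (_ : grid n k l = `[0, 1[%classic `&` ([set x | (e n x < k)%N] `&`
  [set x | (o n x < l)%N])); last first.
  by apply/seteqP; split=> x; rewrite /= in_itv/= => -[]// ? [].
by apply: measurableI => //; apply: measurableI; exact: measurable_ltn.
Qed.

(** Prescribing both binary strings prescribes the first [n] base-4 digits, which cuts out a single
    interval. *)
Let cell n k l : (k < 2 ^ n)%N -> (l < 2 ^ n)%N ->
  U01 [set x | [/\ 0 <= x < 1, e n x = k & o n x = l]] = ((4 ^+ n)^-1)%:E.
Proof.
move=> kn ln; set m := interleave n k l.
have mn : (m < 4 ^ n)%N by exact: interleave_lt.
have p0 : 0 < 4 ^+ n :> R by rewrite exprn_gt0.
have mn' : m.+1%:R <= 4 ^+ n :> R by rewrite -natrX ler_nat.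
rewrite (_ : [set _ | _] = `[m%:R / 4 ^+ n, m.+1%:R / 4 ^+ n[%classic); last first.
  have aE x : 0 <= x -> (x \in `[m%:R / 4 ^+ n, m.+1%:R / 4 ^+ n[) = (a n x == m).
    move=> x0; rewrite in_itv/= ler_pdivrMr// ltr_pdivlMr// mulrC.
    by rewrite truncn_eq// mulr_ge0// ltW.
  apply/seteqP; split=> x /=.
    move=> [/andP[x0 x1] ek ol]; rewrite aE//; apply/eqP.
    apply/(interleaveP kn ln); last by [].
    rewrite -(ltr_nat R) natrX; apply: (@le_lt_trans _ _ (4 ^+ n * x)).
      by rewrite truncn_le// mulr_ge0// ltW.
    by rewrite gtr_pMr.
  move=> xI; have /andP[x0 x1] : 0 <= x < 1.
    move: xI; rewrite in_itv/= => /andP[mx xm].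
    rewrite (le_trans _ mx) ?divr_ge0 ?ler0n ?(ltW p0)//=.
    by rewrite (lt_le_trans xm)// ler_pdivrMr ?mul1r.
  move: xI; rewrite aE// => /eqP am.
  have [] := (interleaveP kn ln (a := a n x) _).2 am; first by rewrite am.
  by rewrite x0 x1.
rewrite (uniform01_itv erefl).
- by congr EFin; rewrite -mulrBl -[m.+1%:R]natr1 addrAC subrr add0r mul1r.
- by rewrite divr_ge0 ?ler0n ?ltW.
- by rewrite ler_pM2r ?invr_gt0// ler_nat.
- by rewrite ler_pdivrMr ?mul1r.
Qed.

Let grid_prob n k l : (k <= 2 ^ n)%N -> (l <= 2 ^ n)%N ->
  U01 (grid n k l) = ((k * l)%:R / 4 ^+ n)%:E.
Proof.
pose row k l : set R := [set x | [/\ 0 <= x < 1, e n x = k & (o n x < l)%N]].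
pose cel k l : set R := [set x | [/\ 0 <= x < 1, e n x = k & o n x = l]].
have mrow i j : measurable (row i j).
  rewrite (_ : row i j = grid n i.+1 j `\` grid n i j); first exact: measurableD.
  apply/seteqP; split=> [x [? <- ?]|x [[? ei ?] h]]; split => //.
    by move=> [_]; rewrite ltnn.
  by apply/eqP; rewrite eqn_leq -ltnS ei leqNgt; apply/negP => ei'; apply: h.
have mcel i j : measurable (cel i j).
  rewrite (_ : cel i j = row i j.+1 `\` row i j); first exact: measurableD.
  apply/seteqP; split=> [x [? ? <-]|x [[? ? oj] h]]; split => //.
    by move=> [_ _]; rewrite ltnn.
  by apply/eqP; rewrite eqn_leq -ltnS oj leqNgt; apply/negP => oj'; apply: h.
have celP i j : (i < 2 ^ n)%N -> (j < 2 ^ n)%N ->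
    U01 (cel i j) = ((4 ^+ n)^-1)%:E by exact: cell.
have rowP i j : (i < 2 ^ n)%N -> (j <= 2 ^ n)%N -> U01 (row i j) = (j%:R / 4 ^+ n)%:E.
  move=> i2; elim: j => [_|j IH j2].
    rewrite mul0r (_ : row i 0%N = set0) ?measure0//.
    by apply/seteqP; split=> // x [].
  rewrite (_ : row i j.+1 = row i j `|` cel i j); last first.
    apply/seteqP; split=> [x [? ?]|x [[? ? ?]|[? ? ?]]].
    - by rewrite ltnS leq_eqVlt => /predU1P[?|?]; [right|left].
    - by split => //; lia.
    - by split => //; lia.
  rewrite measureU; [|exact: mrow|exact: mcel|]; last first.
    by apply/seteqP; split=> // x [[_ _ +] [_ _ oj]]; rewrite oj ltnn.
  by rewrite /= celP// IH ?(ltnW j2)// -EFinD -[j.+1%:R]natr1 mulrDl mul1r.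
elim: k => [_ _|k IH k2 l2].
  rewrite mul0n mul0r (_ : grid _ _ _ = set0) ?measure0//.
  by apply/seteqP; split=> // x [].
rewrite (_ : grid n k.+1 l = grid n k l `|` row k l); last first.
  apply/seteqP; split=> [x [? + ?]|x [[? ? ?]|[? ? ?]]].
  - by rewrite ltnS leq_eqVlt => /predU1P[?|?]; [right|left].
  - by split => //; lia.
  - by split => //; lia.
rewrite measureU; [|exact: measurable_grid|exact: mrow|]; last first.
  by apply/seteqP; split=> // x [[_ + _] [_ ek _]]; rewrite ek ltnn.
by rewrite /= rowP// IH ?(ltnW k2)// -EFinD mulSn natrD addrC mulrDl.
Qed.

Let hi x := sups (fun n => (e n x)%:R / 2 ^+ n : R) 0.
Let lo x := sups (fun n => (o n x)%:R / 2 ^+ n : R) 0.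

Let hiP n x : (e n x)%:R / 2 ^+ n <= hi x <= (e n x).+1%:R / 2 ^+ n.
Proof.
by apply: sup_binary_expansion => m; [exact: even_digits_lt|exact: eS].
Qed.

Let loP n x : (o n x)%:R / 2 ^+ n <= lo x <= (o n x).+1%:R / 2 ^+ n.
Proof.
by apply: sup_binary_expansion => m; [exact: odd_digits_lt|exact: oS].
Qed.

Let hi01 x : 0 <= hi x <= 1.
Proof. by have := hiP 0 x; rewrite /e /= expr0 !divr1. Qed.

Let lo01 x : 0 <= lo x <= 1.
Proof. by have := loP 0 x; rewrite /o /= expr0 !divr1. Qed.

Let measurable_sups (f : nat -> nat -> nat) : (forall n i, (f n i < 2 ^ n)%N) ->
  measurable_fun setT (fun x => sups (fun n => (f n (a n x))%:R / 2 ^+ n : R) 0).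
Proof.
move=> f2; apply: (measurable_fun_sups (h := fun n x => (f n (a n x))%:R / 2 ^+ n)).
  move=> x _; exists 1 => _ [n _ <-].
  by rewrite ler_pdivrMr ?exprn_gt0// mul1r -natrX ler_nat ltnW.
by move=> n; exact: (measurable_comp_a n (f n) (fun i => i%:R / 2 ^+ n)).
Qed.

Let measurable_hi : measurable_fun setT hi.
Proof. by apply: measurable_sups; exact: even_digits_lt. Qed.

Let measurable_lo : measurable_fun setT lo.
Proof. by apply: measurable_sups; exact: odd_digits_lt. Qed.

Let measurable_preim (f : R -> R) (A : set R) :
  measurable_fun setT f -> measurable A -> measurable (f @^-1` A).
Proof. by move=> mf mA; rewrite -[X in measurable X]setTI; exact: mf. Qed.

(** At every depth the event is squeezed between two grids whose sides differ by one cell. *)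
Let corner t u : 0 <= t <= 1 -> 0 <= u <= 1 ->
  U01 (hi @^-1` `]-oo, t] `&` lo @^-1` `]-oo, u]) = (t * u)%:E.
Proof.
move=> /andP[t0 t1] /andP[u0 u1]; set E := _ `&` _.
have mE : measurable E by apply: measurableI; exact: measurable_preim.
have pE : U01 E = (fine (U01 E))%:E by rewrite fineK// fin_num_measure.
rewrite pE; congr EFin; move: (fine _) pE => p pE.
(* With N = 2^n, both p N^2 and t u N^2 lie between k l and (k + 1)(l + 1), which differ by k + l +
   1 <= 3 N. *)
have bnd n : `|p - t * u| <= 3 / 2 ^+ n.
  have N0 : 0 < 2 ^+ n :> R by rewrite exprn_gt0.
  have N1 : 1 <= 2 ^+ n :> R by rewrite exprn_ege1// ler1n.
  have E4 : 4 ^+ n = 2 ^+ n * 2 ^+ n :> R.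
    by rewrite -exprMn; congr (_ ^+ _); rewrite -natrM.
  pose k := Num.truncn (2 ^+ n * t); pose l := Num.truncn (2 ^+ n * u).
  have /andP[k1 k2] : k%:R <= 2 ^+ n * t < k.+1%:R.
    by apply: truncn_itv; rewrite mulr_ge0// ltW.
  have /andP[l1 l2] : l%:R <= 2 ^+ n * u < l.+1%:R.
    by apply: truncn_itv; rewrite mulr_ge0// ltW.
  have kN : k%:R <= 2 ^+ n :> R by apply: le_trans k1 _; rewrite ger_pMr.
  have lN : l%:R <= 2 ^+ n :> R by apply: le_trans l1 _; rewrite ger_pMr.
  have kN' : (k <= 2 ^ n)%N by rewrite -(ler_nat R) natrX.
  have lN' : (l <= 2 ^ n)%N by rewrite -(ler_nat R) natrX.
  have low : (k * l)%:R / 4 ^+ n <= p.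
    rewrite -lee_fin -pE -grid_prob//; apply: le_measure; rewrite ?inE//; first exact: measurable_grid.
    move=> x [_ ek ol]; split; rewrite /= in_itv/=.
      have /andP[_ h] := hiP n x; apply: le_trans h _.
      by rewrite ler_pdivrMr// mulrC (le_trans _ k1)// ler_nat.
    have /andP[_ h] := loP n x; apply: le_trans h _.
    by rewrite ler_pdivrMr// mulrC (le_trans _ l1)// ler_nat.
  have upp : p <= (k.+1 * l.+1)%:R / 4 ^+ n.
    (* The cap matters for [t = 1] or [u = 1], where the next index would leave the grid. *)
    pose k' := minn k.+1 (2 ^ n); pose l' := minn l.+1 (2 ^ n).
    apply: (@le_trans _ _ ((k' * l')%:R / 4 ^+ n)); last first.
      by rewrite ler_pM2r ?invr_gt0 ?exprn_gt0// ler_nat leq_mul ?geq_minl.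
    rewrite -lee_fin -pE -grid_prob ?geq_minr//.
    apply: le_trans (uniform01_le_co mE) _; apply: le_measure; rewrite ?inE.
    - exact: measurableI.
    - exact: measurable_grid.
    - move=> x [[/=]]; rewrite !in_itv/= => ht lu x01; split=> //.
      rewrite leq_min even_digits_lt andbT -(ltr_nat R).
      apply: le_lt_trans k2; rewrite mulrC -ler_pdivrMr//.
      by have /andP[h _] := hiP n x; exact: le_trans h ht.
    rewrite leq_min odd_digits_lt andbT -(ltr_nat R).
    apply: le_lt_trans l2; rewrite mulrC -ler_pdivrMr//.
    by have /andP[h _] := loP n x; exact: le_trans h lu.
  move: low upp; rewrite E4 ler_pdivrMr ?mulr_gt0// ler_pdivlMr ?mulr_gt0//.
  rewrite !natrM => low upp; rewrite -(natr1 k) -(natr1 l) in k2 l2 upp.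
  have k0 : 0 <= k%:R :> R by [].
  have l0 : 0 <= l%:R :> R by [].
  set N := 2 ^+ n in N0 N1 k1 k2 l1 l2 kN lN low upp *.
  have h1 : k%:R * l%:R <= t * u * (N * N).
    rewrite (_ : t * u * (N * N) = (N * t) * (N * u)); last by ring.
    by rewrite ler_pM.
  have h2 : t * u * (N * N) <= (k%:R + 1) * (l%:R + 1).
    rewrite (_ : t * u * (N * N) = (N * t) * (N * u)); last by ring.
    apply: ler_pM; [| |exact: ltW k2|exact: ltW l2].
      by apply: mulr_ge0 => //; exact: ltW.
    by apply: mulr_ge0 => //; exact: ltW.
  have : `|(p - t * u) * (N * N)| <= 3 * N.
    rewrite ler_norml mulrBl; apply/andP; split; lra.
  rewrite normrM (ger0_norm (x := N * N)); last by rewrite mulr_ge0// ltW.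
  by rewrite mulrA ler_pM2r// ler_pdivlMr.
apply/eqP; rewrite -subr_eq0 -normr_eq0 eq_le normr_ge0 andbT.
apply/ler_addgt0Pr => eps eps0; rewrite add0r.
pose n := Num.truncn (3 / eps); apply: le_trans (bnd n.+1) _.
rewrite ler_pdivrMr ?exprn_gt0// mulrC -ler_pdivrMr//.
apply: le_trans (ltW (truncnS_gt _)) _.
by rewrite -natrX ler_nat ltnW// ltn_expl.
Qed.

Let corner_ray t u : U01 (hi @^-1` `]-oo, t] `&` lo @^-1` `]-oo, u]) =
  (U01 `]-oo, t]%classic * U01 `]-oo, u]%classic)%E.
Proof.
have neg (f : R -> R) (s : R) : (forall x, 0 <= f x <= 1) -> s < 0 ->
    f @^-1` `]-oo, s] = set0 /\ U01 `]-oo, s] = 0%E.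
  move=> f01 s0; split.
    apply/seteqP; split=> // x /=; rewrite in_itv/= => fs.
    by have := f01 x; lra.
  rewrite uniform01E// (_ : _ `&` _ = set0) ?measure0//.
  by apply/seteqP; split=> // x [] /=; rewrite !in_itv/=; lra.
have big (f : R -> R) (s : R) : (forall x, 0 <= f x <= 1) -> 1 < s ->
    f @^-1` `]-oo, s] = f @^-1` `]-oo, 1] /\ U01 `]-oo, s] = U01 `]-oo, 1].
  move=> f01 s1; split.
    apply/seteqP; split=> x /=; rewrite !in_itv/= => fs.
      by case/andP: (f01 x).
    exact: le_trans fs (ltW s1).
  rewrite !uniform01E//; congr (mu _).
  apply/seteqP; split=> x [] /=; rewrite !in_itv/= => xs /andP[x0 x1].
    by rewrite x0 x1.
  by rewrite (le_trans xs (ltW s1)) x0 x1.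
wlog t1 : t / t <= 1.
  move=> h; have [|t1] := leP t 1; first exact: h.
  by have [-> ->] := big hi t hi01 t1; exact: h.
wlog u1 : u / u <= 1.
  move=> h; have [|u1] := leP u 1; first exact: h.
  by have [-> ->] := big lo u lo01 u1; exact: h.
have [t0|t0] := ltP t 0.
  by have [-> ->] := neg hi t hi01 t0; rewrite set0I measure0 mul0e.
have [u0|u0] := ltP u 0.
  by have [-> ->] := neg lo u lo01 u0; rewrite setI0 measure0 mule0.
by rewrite !uniform01_ray ?t0 ?u0// corner ?t0 ?u0// EFinM.
Qed.

Lemma uniform_pair_of_uniform : exists f g : R -> R,
  [/\ measurable_fun setT f, measurable_fun setT g,
      forall x, 0 <= f x <= 1 &
      forall A B : set R, measurable A -> measurable B ->
        U01 (f @^-1` A `&` g @^-1` B) = (U01 A * U01 B)%E].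
Proof.
exists hi, lo; split => // A B mA mB.
have fin A' : measurable A' -> U01 A' = (fine (U01 A'))%:E.
  by move=> ?; rewrite fineK// fin_num_measure.
have oo A' : measurable A' -> (U01 A' < +oo)%E.
  by move=> ?; apply: le_lt_trans (probability_le1 _ _) _ => //; exact: ltry.
have step1 u : U01 (hi @^-1` A `&` lo @^-1` `]-oo, u]) =
    (U01 `]-oo, u]%classic * U01 A)%E.
  rewrite (fin `]-oo, u]%classic)//; apply: measure_preimage_eq_rays => //.
  - exact: measurable_preim.
  - by apply: oo; exact: measurable_preim.
  - by rewrite fine_ge0.
  - by move=> x; rewrite -fin// [RHS]muleC; exact: corner_ray.
rewrite setIC (fin A mA); apply: measure_preimage_eq_rays => //.
- exact: measurable_preim.
- by apply: oo; exact: measurable_preim.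
- by rewrite fine_ge0.
- by move=> x; rewrite -fin// [RHS]muleC setIC; exact: step1.
Qed.

End digit_split.

Lemma atomless_uniform_pair d (T : measurableType d) (R : realType)
    (P : probability T R) : atomless P ->
  exists V W : {RV P >-> R}, (forall w, 0 <= V w <= 1) /\
    forall E : set (R * R), measurable E ->
      P [set w | E (V w, W w)] =
      (uniform_prob (@ltr01 R) \x uniform_prob (@ltr01 R))%E E.
Proof.
move=> aP; have [V0 [V01 V0t]] := atomless_uniform aP.
set U01 := uniform_prob (@ltr01 R).
have [f [g [mf mg f01 fg]]] := uniform_pair_of_uniform R.
have law (A : set R) : measurable A -> P (V0 @^-1` A) = U01 A.
  move=> mA; rewrite -[V0 @^-1` A]setIT -[RHS]mul1e.
  apply: measure_preimage_eq_rays => //.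
    by rewrite ltey_eq fin_num_measure.
  move=> x; rewrite setIT mul1e /=.
  have [x0|x0] := ltP x 0.
    rewrite uniform01E// (_ : V0 @^-1` _ = set0) ?measure0; last first.
      apply/seteqP; split=> // w /=; rewrite in_itv/= => Vx.
      by have := V01 w; lra.
    have -> : `]-oo, x] `&` `[0, 1] = set0 :> set R.
      by apply/seteqP; split=> // z [] /=; rewrite !in_itv/=; lra.
    by rewrite measure0.
  have [x1|x1] := leP x 1.
    by rewrite uniform01_ray ?x0 ?x1// -V0t ?x0 ?x1//.
  rewrite (_ : V0 @^-1` _ = setT); last first.
    apply/seteqP; split=> // w _ /=; rewrite in_itv/=.
    by have := V01 w; lra.
  rewrite probability_setT uniform01E// setIidr.
    by rewrite lebesgue_measure_itv/= lte_fin ltr01 sube0.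
  by move=> z /=; rewrite !in_itv/=; lra.
have mV : measurable_fun setT (f \o V0) by exact: measurableT_comp.
have mW : measurable_fun setT (g \o V0) by exact: measurableT_comp.
pose V : {RV P >-> R} := HB.pack (f \o V0) (isMeasurableFun.Build _ _ _ _ _ mV).
pose W : {RV P >-> R} := HB.pack (g \o V0) (isMeasurableFun.Build _ _ _ _ _ mW).
exists V, W; split=> [w|E mE]; first exact: f01.
pose VW w := (V w : measurableTypeR R, W w : measurableTypeR R).
have mVW : measurable_fun setT VW.
  by apply: measurable_fun_pair.
pose m : {measure set (measurableTypeR R * measurableTypeR R) -> \bar R} :=
  measure_function_pushforward__canonical__measure_function_Measure P mVW.
have mE' : forall A B : set R, measurable A -> measurable B -> m (A `*` B) = (U01 A * U01 B)%E.
  move=> A B mA mB; transitivity (U01 (f @^-1` A `&` g @^-1` B)); last exact: fg.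
  rewrite -law//.
  apply: measurableI; rewrite -[X in measurable X]setTI; [exact: mf|exact: mg].
apply/esym; have := @product_measure_unique _ _ _ _ R U01 U01 m mE' E mE.
by [].
Qed.

(** The values 0 and 1 have to be avoided at every outcome, since the quantile function can be
    infinite there. On the null event where the first variable hits them it is reset to 1/2, which
    leaves the joint law unchanged. *)
Lemma atomless_uniform_pair_oo d (T : measurableType d) (R : realType)
    (P : probability T R) : atomless P ->
  exists V W : {RV P >-> R}, (forall w, 0 < V w < 1) /\
    forall E : set (R * R), measurable E ->
      P [set w | E (V w, W w)] =
      (uniform_prob (@ltr01 R) \x uniform_prob (@ltr01 R))%E E.
Proof.
move=> /atomless_uniform_pair[V [W [_ VW]]].
pose f (x : R) : R := if x \in `]0, 1[ then x else 2^-1.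
have mf : measurable_fun setT f.
  apply: measurable_fun_ifT => //.
  apply: (measurable_fun_bool true); rewrite setTI.
  have -> : (fun x : R => x \in `]0, 1[) @^-1` [set true] = `]0, 1[%classic.
    by apply/seteqP; split.
  exact: measurable_itv.
have mfV : measurable_fun setT (f \o V) by exact: measurableT_comp.
pose V' : {RV P >-> R} := HB.pack (f \o V) (isMeasurableFun.Build _ _ _ _ _ mfV).
have mpair (U : {RV P >-> R}) (E : set (R * R)) : measurable E ->
    measurable [set w | E (U w, W w)].
  move=> mE; have mUW : measurable_fun setT (fun w => (U w, W w)).
    exact: measurable_fun_pair.
  by rewrite -[X in measurable X]setTI; exact: mUW.
pose B : set (R * R) := (~` `]0, 1[) `*` setT.
have mB : measurable B by apply: measurableX => //; exact: measurableC.
pose N := [set w | B (V w, W w)].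
have mN : measurable N by exact: mpair.
have N0 : P N = 0%E.
  rewrite VW// product_measure1E//; last exact: measurableC.
  rewrite /= uniform01_oo; last exact: measurableC.
  by rewrite setICl measure0 mul0e.
have le (A A' : set T) : measurable A -> measurable A' ->
    A `<=` A' `|` N -> (P A <= P A')%E.
  move=> mA mA' AA'; apply: (@le_trans _ _ (P (A' `|` N))).
    by apply: le_measure; rewrite ?inE//; exact: measurableU.
  apply: le_trans (measureU2 _ _ _) _ => //.
  by rewrite -[leRHS]adde0 leeD2l//= N0.
have V'E w : ~ N w -> V' w = V w.
  move=> /not_andP[/contrapT|/(_ I)//].
  by rewrite /V' /= /f => ->.
exists V', W; split=> [w|E mE].
  rewrite /V' /= /f; case: ifPn => // _.
  by rewrite invr_gt0 ltr0n/= invf_lt1// ltr1n.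
rewrite -VW//; apply/eqP; rewrite eq_le; apply/andP; split.
  apply: le; [exact: mpair|exact: mpair|move=> w Ew].
  by have [Nw|Nw] := pselect (N w); [right|left; rewrite /mkset -(V'E w Nw)].
apply: le; [exact: mpair|exact: mpair|move=> w Ew].
by have [Nw|Nw] := pselect (N w); [right|left; rewrite /mkset (V'E w Nw)].
Qed.

(** * Quantiles *)

Lemma nondecreasing_itv_measurable (R : realType) (D : set R) (f : R -> R) :
  is_interval D -> {in D &, {homo f : x y / x <= y}} -> measurable_fun D f.
Proof.
move=> iD fD mD; apply: (measurability _ (RGenCInfty.measurableE R)) => //.
move=> _ [_ [r ->] <-]; apply: is_interval_measurable => x y /= [Dx fx] [Dy fy] z.
move=> /andP[xz zy]; have Dz : D z by apply: (iD x y); rewrite ?xz.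
move: fx; rewrite !in_itv/= !andbT => fx; split => //; apply: le_trans fx _.
by apply: fD; rewrite ?inE.
Qed.

Lemma nonincreasing_itv_measurable (R : realType) (D : set R) (f : R -> R) :
  is_interval D -> {in D &, {homo f : x y /~ x <= y}} -> measurable_fun D f.
Proof.
move=> iD fD; rewrite -[f]opprK; apply: measurable_funN.
apply: nondecreasing_itv_measurable => // x y Dx Dy xy.
by rewrite /GRing.opp/= lerN2 fD.
Qed.

Section quantile.
Context (R : realType) (F : cumulativeBounded (0 : R) (1 : R)).
Notation mu := (@lebesgue_measure R).
Notation U01 := (uniform_prob (@ltr01 R)).
Notation lsF := (lebesgue_stieltjes_measure F).

Lemma cumulativeBounded_le x y : x <= y -> F x <= F y.
Proof. exact: cumulative_is_nondecreasing. Qed.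

Lemma cumulativeBounded_right_le x t : (forall y, x < y -> t <= F y) -> t <= F x.
Proof.
move=> h; have Fx : F y @[y --> x^'+] --> F x.
  exact: cumulative_is_right_continuous.
rewrite -(cvg_lim _ Fx)//; apply: limr_ge; first by apply/cvg_ex; exists (F x).
by near=> y; apply: h.
Unshelve. all: by end_near. Qed.

(** Right-continuity of [F] makes the infimum usable as a minimum; positivity of [t] selects the
    branch of the definition with a large inequality. *)
Lemma quantile_le t x : 0 < t -> (quantile F t <= x%:E)%E = (t <= F x).
Proof.
move=> t0; rewrite /quantile gt_eqF//; apply/idP/idP => [qx|tx]; last first.
  by apply: ereal_inf_lbound; exists x.
apply: cumulativeBounded_right_le => y xy.
have xy' : (x%:E < y%:E)%E by rewrite lte_fin.
have /ereal_inf_lt[_ [z /= tz <-]] := le_lt_trans qx xy'.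
by rewrite lte_fin => zy; apply: le_trans tz _; apply: cumulativeBounded_le; exact: ltW.
Qed.

Lemma quantile_gtNy t : 0 < t -> (-oo < quantile F t)%E.
Proof.
move=> t0; have [x Fx] : exists x, F x < t.
  near (-oo : set_system R) => x; exists x; near: x.
  exact: (cvgr_lt _ (cumulativeNy F)).
apply: (@lt_le_trans _ _ x%:E); first by rewrite ltNyr.
by rewrite leNgt; apply/negP => /ltW; rewrite quantile_le// leNgt Fx.
Unshelve. all: by end_near. Qed.

Lemma quantile_fin_num t : 0 < t < 1 -> quantile F t \is a fin_num.
Proof.
move=> /andP[t0 t1]; rewrite fin_numElt quantile_gtNy//=.
have [x Fx] : exists x, t < F x.
  near (+oo : set_system R) => x; exists x; near: x.
  exact: (cvgr_gt _ (cumulativey F)).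
apply: (@le_lt_trans _ _ x%:E); last by rewrite ltry.
by rewrite quantile_le// ltW.
Unshelve. all: by end_near. Qed.

Lemma cumulativeBounded01 x : 0 <= F x <= 1.
Proof.
apply/andP; split; rewrite leNgt; apply/negP => Fx.
  near (-oo : set_system R) => y.
  have : F x < F y by near: y; exact: (cvgr_gt _ (cumulativeNy F)).
  by rewrite ltNge cumulativeBounded_le//; near: y; exact: nbhs_ninfty_le.
near (+oo : set_system R) => y.
have : F y < F x by near: y; exact: (cvgr_lt _ (cumulativey F)).
by rewrite ltNge cumulativeBounded_le//; near: y; exact: nbhs_pinfty_ge.
Unshelve. all: by end_near. Qed.

(** The cut-off removes the endpoints, where [fine] could be applied to an infinite value. *)
Definition rquantile : R -> R := (fun t => fine (quantile F t)) \_ `]0, 1[.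

Lemma rquantileE t : 0 < t < 1 -> quantile F t = (rquantile t)%:E.
Proof.
move=> t01; rewrite /rquantile patchE mem_set/= ?in_itv//=.
by rewrite fineK// quantile_fin_num.
Qed.

Lemma rquantile_le t x : 0 < t < 1 -> (rquantile t <= x) = (t <= F x).
Proof.
by move=> t01; rewrite -lee_fin -rquantileE// quantile_le//; case/andP: t01.
Qed.

Lemma rquantile_nondecreasing : {in `]0, 1[ &, {homo rquantile : x y / x <= y}}.
Proof.
move=> x y; rewrite !in_itv/= => x01 y01 xy.
by rewrite rquantile_le// (le_trans xy)// -rquantile_le.
Qed.

Lemma measurable_rquantile : measurable_fun setT rquantile.
Proof.
apply/(measurable_restrictT _ (measurable_itv _)).
apply: nondecreasing_itv_measurable; first exact: interval_is_interval.
move=> x y; rewrite !inE/= => x01 y01 xy; rewrite -lee_fin.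
have := rquantile_nondecreasing x01 y01 xy; rewrite -lee_fin.
by rewrite !rquantileE// !fineK ?quantile_fin_num.
Qed.

Lemma law_rquantile (A : set R) : measurable A -> U01 (rquantile @^-1` A) = lsF A.
Proof.
move=> mA; rewrite -[_ @^-1` A]setIT -[RHS]mul1e.
apply: measure_preimage_eq_rays => //; first exact: measurable_rquantile.
  by rewrite ltey_eq fin_num_measure.
move=> x; rewrite setIT mul1e.
transitivity (F x)%:E; last by apply/esym; exact: cdf_lebesgue_stieltjes_id.
rewrite /= uniform01_oo; last first.
  by rewrite -[X in measurable X]setTI; exact: measurable_rquantile.
have := cumulativeBounded01 x; move Ey : (F x) => y y01.
rewrite -(@uniform01_ray _ y)// [RHS]uniform01_oo//; congr mu.
apply/seteqP; split=> t /= []; rewrite !in_itv/= => h t01; split => //; move: h.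
  by rewrite rquantile_le// Ey.
by rewrite rquantile_le// Ey.
Qed.

Lemma ge0_integral_law (f : R -> \bar R) : measurable_fun setT f ->
  (forall x, 0 <= f x)%E ->
  (\int[lsF]_x f x = \int[mu]_(t in `[0%R, 1%R]) f (rquantile t))%E.
Proof.
move=> mf f0.
pose q : R -> measurableTypeR R := rquantile.
have mq : measurable_fun setT (q : measurableTypeR R -> _).
  exact: measurable_rquantile.
transitivity (\int[pushforward U01 q]_x f x)%E.
  by apply: eq_measure_integral => A mA _; apply/esym; exact: law_rquantile.
rewrite ge0_integral_pushforward// preimage_setT integral_uniform//.
  by rewrite subr0 invr1 mul1e.
- exact: measurableT_comp.
- by move=> x; exact: f0.
Qed.

Hypothesis meanF : finite_mean F.

Lemma integrable_rquantile : mu.-integrable `[0, 1] (EFin \o rquantile).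
Proof.
have /integrableP[mx xoo] := meanF; apply/integrableP; split.
  by apply/measurable_EFinP/measurable_funTS; exact: measurable_rquantile.
by move: xoo; rewrite ge0_integral_law//; exact: measurableT_comp.
Qed.

Lemma integral_rquantile : \int[mu]_(t in `[0, 1]) rquantile t = mean F.
Proof.
rewrite /mean /Rintegral; congr fine; rewrite integralE [RHS]integralE.
have mE : measurable_fun setT (EFin : R -> \bar R) by [].
rewrite [in RHS]ge0_integral_law; [|exact: measurable_funepos|exact: funepos_ge0].
rewrite [X in (_ = _ - X)%E]ge0_integral_law; [|exact: measurable_funeneg|exact: funeneg_ge0].
by congr (_ - _)%E; apply: eq_integral => t _; rewrite ?funeposE ?funenegE.
Qed.

Definition slope (t : R) := rquantile t - mean F.

Lemma measurable_slope : measurable_fun setT slope.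
Proof. by apply: measurable_funB => //; exact: measurable_rquantile. Qed.

Let integrable_mean : mu.-integrable `[0, 1] (EFin \o cst (mean F)).
Proof.
apply/integrableP; split=> [|/=]; first exact/measurable_EFinP/measurable_cst.
rewrite integral_cst//= lebesgue_measure_itv/= lte_fin ltr01 -EFinB -EFinM.
exact: ltry.
Qed.

Lemma integrable_slope : mu.-integrable `[0, 1] (EFin \o slope).
Proof.
exact: (integrableB _ integrable_rquantile integrable_mean).
Qed.

Lemma integral_slope : \int[mu]_(t in `[0, 1]) slope t = 0.
Proof.
rewrite RintegralB//=; last exact: integrable_rquantile.
rewrite integral_rquantile Rintegral_cst//=.
by rewrite lebesgue_measure_itv/= lte_fin ltr01 sube0/= mulr1 subrr.
Qed.

(** The endpoints, where the extended quantile may be infinite, form a null set, so the integrand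
    can be made real. *)
Lemma res_HE s : 0 <= s <= 1 -> res_H F s = \int[mu]_(t in `[0, s]) slope t.
Proof.
move=> /andP[s0 s1]; rewrite /res_H /Rintegral; congr fine.
have eqE : {in `]0, s[%classic, (fun t => quantile F t - (mean F)%:E)%E =1 EFin \o slope}.
  move=> t; rewrite inE/= in_itv/= => /andP[t0 ts].
  by rewrite rquantileE// t0 (lt_le_trans ts).
have mslope : measurable_fun `]0, s[ (EFin \o slope).
  by apply/measurable_EFinP/measurable_funTS; exact: measurable_slope.
transitivity (\int[mu]_(t in `]0%R, s[) (quantile F t - (mean F)%:E))%E.
  apply: integral_itv_bndoo; apply: eq_measurable_fun mslope => t /eqE.
  by move=> ->.
transitivity (\int[mu]_(t in `]0%R, s[) (EFin \o slope) t)%E.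
  by apply: eq_integral => t /eqE.
by apply/esym; exact: integral_itv_bndoo mslope.
Qed.

Let nu := res_nu F.
Let nup := res_nup F.
Let m := mean F.

Let cvg_at_left_mean : cvg (F x @[x --> m^'-]).
Proof.
apply: nondecreasing_at_left_is_cvgr.
  by near=> y => a b _ _; exact: cumulativeBounded_le.
by near=> y; exists 1 => _ [z _ <-]; case/andP: (cumulativeBounded01 z).
Unshelve. all: by end_near. Qed.

Lemma cumulativeBounded_le_res_nu x : x < m -> F x <= nu.
Proof.
move=> xm; apply: limr_ge => //; near=> y; apply: cumulativeBounded_le; apply: ltW.
by near: y; exact: nbhs_left_gt.
Unshelve. all: by end_near. Qed.

Lemma res_nu_lt t : t < nu -> exists2 x, x < m & t <= F x.
Proof.
move=> tn; apply: contrapT => h; move: tn; rewrite ltNge => /negP; apply.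
apply: limr_le => //; near=> y; rewrite leNgt; apply/negP => /ltW ty.
by apply: h; exists y.
Unshelve. all: by end_near. Qed.

Lemma res_nu_ge0 : 0 <= nu.
Proof.
have /andP[+ _] := cumulativeBounded01 (m - 1); move/le_trans; apply; apply: cumulativeBounded_le_res_nu.
by rewrite ltrBlDr ltrDl.
Qed.

Lemma res_nu_le_nup : nu <= nup.
Proof. by apply: limr_le => //; near=> y; apply: cumulativeBounded_le; exact: ltW.
Unshelve. all: by end_near. Qed.

Lemma res_nup_le1 : nup <= 1.
Proof. by case/andP: (cumulativeBounded01 m). Qed.

Lemma slope_lt0 t : 0 < t < 1 -> t < nu -> slope t < 0.
Proof.
move=> t01 /res_nu_lt[x xm tx]; rewrite subr_lt0; apply: le_lt_trans xm.
by rewrite rquantile_le.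
Qed.

Lemma slope_gt0 t : 0 < t < 1 -> nup < t -> 0 < slope t.
Proof. by move=> t01 tn; rewrite subr_gt0 ltNge rquantile_le// -ltNge. Qed.

Lemma slope_eq0 t : 0 < t < 1 -> nu < t -> t <= nup -> slope t = 0.
Proof.
move=> t01 nt tn; apply/eqP; rewrite subr_eq0 eq_le rquantile_le// tn/=.
rewrite leNgt; apply/negP => qm.
have [qx xm] := midf_lt qm; move: qx xm; set x := _ / 2 => qx xm.
move: (ltW qx); rewrite rquantile_le// leNgt => /negP; apply.
by apply: le_lt_trans nt; exact: cumulativeBounded_le_res_nu.
Qed.

End quantile.

(** * The function H and the law of H(V) *)

(** A zero integral would force [f] to vanish almost everywhere on an interval of positive
    length. *)
Lemma Rintegral_itv_gt0 (R : realType) (f : R -> R) (x y : R) : x < y ->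
  (@lebesgue_measure R).-integrable `]x, y[ (EFin \o f) ->
  (forall t, x < t < y -> 0 < f t) ->
  0 < \int[@lebesgue_measure R]_(t in `]x, y[) f t.
Proof.
move=> xy intf f0; have f0' t : `]x, y[%classic t -> 0 < f t by move/f0.
rewrite lt_neqAle eq_sym Rintegral_ge0 ?andbT; last by move=> t /f0'/ltW.
apply/eqP => I0.
have : (\int[@lebesgue_measure R]_(t in `]x, y[) `|(EFin \o f) t| = 0)%E.
  transitivity (\int[@lebesgue_measure R]_(t in `]x, y[) (f t)%:E)%E.
    by apply: eq_integral => t; rewrite inE => /f0' /ltW ft; rewrite gee0_abs.
  rewrite -[LHS]fineK ?integrable_fin_num//.
  by congr EFin.
move=> /ae_eq_integral_abs[//||N [mN N0 DN]].
  by have /integrableP[] := intf.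
have : (lebesgue_measure (`]x, y[%classic : set R) <= lebesgue_measure N)%E.
  apply: le_measure; rewrite ?inE// => t xyt; apply: DN => /= /(_ xyt) [ft].
  by have := f0' t xyt; rewrite ft ltxx.
by rewrite N0 lebesgue_measure_itv/= lte_fin xy -EFinB lee_fin leNgt subr_gt0 xy.
Qed.

Section valley.
Context (R : realType) (F : cumulativeBounded (0 : R) (1 : R)).
Hypothesis meanF : finite_mean F.
Notation mu := (@lebesgue_measure R).
Notation H := (res_H F).
Notation nu := (res_nu F).
Notation nup := (res_nup F).
Notation c := (res_c F).
Notation slope := (slope F).

Let integrable_slopeS (D : set R) : measurable D -> D `<=` `[0, 1] ->
  mu.-integrable D (EFin \o slope).
Proof. by move=> mD sD; apply: integrableS (integrable_slope meanF). Qed.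

Lemma res_H_sub x y : 0 <= x -> x <= y -> y <= 1 ->
  H y - H x = \int[mu]_(t in `]x, y[) slope t.
Proof.
move=> x0 xy y1; rewrite !res_HE ?x0 ?(le_trans x0)// ?(le_trans xy)//.
rewrite Rintegral_itvB ?bnd_simp//; last first.
  by apply: integrable_slopeS => //; apply: subset_itvl; rewrite bnd_simp.
rewrite -Rintegral_itv_bndo_bndc//; apply: integrable_slopeS => //.
by apply: subset_itv; rewrite bnd_simp// ltW.
Qed.

Lemma res_H_lt_decr x y : 0 <= x -> x < y -> y <= nu -> H y < H x.
Proof.
move=> x0 xy yn; have y1 := le_trans yn (le_trans (res_nu_le_nup F) (res_nup_le1 F)).
have intx : mu.-integrable `]x, y[ (EFin \o slope).
  by apply: integrable_slopeS => //; apply: subset_itv; rewrite bnd_simp.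
rewrite -subr_lt0 res_H_sub ?(ltW xy)// -oppr_gt0.
rewrite -mulN1r -RintegralZl//; apply: Rintegral_itv_gt0 => //.
  exact: (integrableZl _ (-1) intx).
move=> t /andP[xt ty]; rewrite mulN1r oppr_gt0; apply: slope_lt0.
  by rewrite (le_lt_trans x0)// (lt_le_trans ty).
exact: lt_le_trans yn.
Qed.

Lemma res_H_lt_incr x y : nup <= x -> x < y -> y <= 1 -> H x < H y.
Proof.
move=> nx xy y1.
have x0 := le_trans (res_nu_ge0 F) (le_trans (res_nu_le_nup F) nx).
rewrite -subr_gt0 res_H_sub ?(ltW xy)//; apply: Rintegral_itv_gt0 => //.
  by apply: integrable_slopeS => //; apply: subset_itv; rewrite bnd_simp.
move=> t /andP[xt ty]; apply: slope_gt0.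
  by rewrite (le_lt_trans x0)// (lt_le_trans ty).
exact: le_lt_trans xt.
Qed.

Lemma res_H_flat x y : nu <= x -> x <= y -> y <= nup -> H x = H y.
Proof.
move=> nx xy yn; have y1 := le_trans yn (res_nup_le1 F).
have x0 := le_trans (res_nu_ge0 F) nx.
apply/esym/eqP; rewrite -subr_eq0 res_H_sub//; apply/eqP.
transitivity (\int[mu]_(t in `]x, y[) (0 : R)); last first.
  by rewrite Rintegral_cst// mul0r.
apply: eq_Rintegral => t; rewrite inE/= in_itv/= => /andP[xt ty]; apply: slope_eq0.
- by rewrite (le_lt_trans x0)// (lt_le_trans ty).
- exact: le_lt_trans xt.
- by apply: ltW; exact: lt_le_trans yn.
Qed.

Lemma res_H0 : H 0 = 0.
Proof. by rewrite res_HE ?lexx ?ler01// set_itv1 Rintegral_set1. Qed.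

Lemma res_H1 : H 1 = 0.
Proof. by rewrite res_HE ?lexx ?ler01// integral_slope. Qed.

Lemma res_cE : c = H nup.
Proof. by rewrite /res_c; apply: res_H_flat; rewrite ?res_nu_le_nup. Qed.

Lemma res_H_continuous : {within `[0, 1], continuous H}.
Proof.
have := parameterized_integral_continuous ler01 (integrable_slope meanF).
apply: subspace_eq_continuous => x; rewrite inE/= in_itv/= => x01.
by apply/esym; exact: res_HE.
Qed.

Lemma res_A_exists s : c <= s <= 0 -> exists2 a, 0 <= a <= nu & H a = s.
Proof.
move=> /andP[cs s0]; have n0 := res_nu_ge0 F.
have n1 := le_trans (res_nu_le_nup F) (res_nup_le1 F).
have cH : {within `[0, nu], continuous H}.
  apply: continuous_subspaceW res_H_continuous.
  by apply: subset_itvl; rewrite bnd_simp.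
have [|a a0 Ha] := IVT (v := s) n0 cH; last by exists a; rewrite // -in_itv.
rewrite res_H0 ge_min cs orbT/=; by rewrite le_max s0.
Qed.

Lemma res_B_exists s : c <= s <= 0 -> exists2 b, nup <= b <= 1 & H b = s.
Proof.
move=> /andP[cs s0]; have n1 := res_nup_le1 F.
have cH : {within `[nup, 1], continuous H}.
  apply: continuous_subspaceW res_H_continuous.
  by apply: subset_itvr; rewrite bnd_simp (le_trans (res_nu_ge0 F))// res_nu_le_nup.
have [|b b0 Hb] := IVT (v := s) n1 cH; last by exists b; rewrite // -in_itv.
by rewrite res_H1 -res_cE ge_min cs/= le_max s0 orbT.
Qed.

Lemma res_AP s : c < s <= 0 -> 0 <= res_A F s < nu /\ H (res_A F s) = s.
Proof.
move=> cs; rewrite /res_A cs; apply: (@xgetPex _ 0 [set a | 0 <= a < nu /\ H a = s]).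
have [|a /andP[a0 an] Ha] := res_A_exists (s := s); first by case/andP: cs => /ltW->.
exists a; split => //; rewrite a0 lt_neqAle an andbT.
by apply/eqP => an'; move: cs; rewrite -Ha an' /res_c ltxx.
Qed.

Lemma res_BP s : c < s <= 0 -> nup < res_B F s <= 1 /\ H (res_B F s) = s.
Proof.
move=> cs; rewrite /res_B cs; apply: (@xgetPex _ 0 [set b | nup < b <= 1 /\ H b = s]).
have [|b /andP[nb b1] Hb] := res_B_exists (s := s); first by case/andP: cs => /ltW->.
exists b; split => //; rewrite b1 lt_neqAle nb !andbT.
by apply/eqP => nb'; move: cs; rewrite -Hb -nb' res_cE ltxx.
Qed.

(** [H] is strictly decreasing, then constant, then strictly increasing, with breaks at [nu] and
    [nup]. The closed ranges for [a] and [b] include the bottom level [c]. *)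
Lemma res_H_sublevel a b v : 0 <= a <= nu -> nup <= b <= 1 -> H a = H b ->
  0 <= v <= 1 -> (H v <= H a) = (a <= v <= b).
Proof.
move=> /andP[a0 an] /andP[nb b1] ab /andP[v0 v1].
have [va|av] := ltP v a; first by rewrite leNgt res_H_lt_decr.
have [bv|vb] := ltP b v.
  by rewrite ab leNgt res_H_lt_incr//= leNgt bv.
rewrite [RHS]/=; apply/idP; have [vn|nv] := leP v nu.
  move: av; rewrite le_eqVlt => /predU1P[->//|av].
  by apply: ltW; exact: res_H_lt_decr.
have [vn|nv'] := leP v nup.
  rewrite (@res_H_flat v nup) ?(ltW nv)// ab.
  move: nb; rewrite le_eqVlt => /predU1P[->//|nb].
  by apply: ltW; exact: res_H_lt_incr.
rewrite ab; move: vb; rewrite le_eqVlt => /predU1P[->//|vb].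
by apply: ltW; apply: res_H_lt_incr => //; exact: ltW.
Qed.

Lemma res_H_ge_c v : 0 <= v <= 1 -> c <= H v.
Proof.
move=> /andP[v0 v1]; have [vn|nv] := leP v nu.
  move: vn; rewrite le_eqVlt => /predU1P[->//|vn].
  by apply: ltW; exact: res_H_lt_decr.
have [vn|nv'] := leP v nup.
  by rewrite (@res_H_flat v nup) ?(ltW nv)// res_cE.
by rewrite res_cE ltW// res_H_lt_incr.
Qed.

Lemma res_H_le0 v : 0 <= v <= 1 -> H v <= 0.
Proof.
move=> v01; have n0 := res_nu_ge0 F; have n1 := res_nup_le1 F.
by rewrite -res_H0 (@res_H_sublevel 0 1)// ?n0 ?n1 ?lexx// res_H0 res_H1.
Qed.

Lemma res_c_le0 : c <= 0.
Proof.
apply: res_H_le0; rewrite res_nu_ge0/=.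
exact: le_trans (res_nu_le_nup F) (res_nup_le1 F).
Qed.

Lemma res_H_lt0 v : c < 0 -> 0 < v < 1 -> H v < 0.
Proof.
move=> c0 /andP[v0 v1]; have [vn|nv] := leP v nu.
  by rewrite -res_H0; exact: res_H_lt_decr.
have [vn|nv'] := leP v nup.
  by rewrite (@res_H_flat v nup) ?(ltW nv)// -res_cE.
by rewrite -res_H1; apply: res_H_lt_incr => //; exact: ltW.
Qed.

End valley.

Section level_law.
Context (R : realType) (F : cumulativeBounded (0 : R) (1 : R)).
Hypothesis meanF : finite_mean F.
Notation mu := (@lebesgue_measure R).
Notation U01 := (uniform_prob (@ltr01 R)).
Notation H := (res_H F).
Notation nu := (res_nu F).
Notation nup := (res_nup F).
Notation c := (res_c F).
Notation slope := (slope F).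

Definition level : R -> R := H \_ `[0, 1].

Lemma levelE v : 0 <= v <= 1 -> level v = H v.
Proof. by move=> v01; rewrite /level patchE mem_set//= in_itv. Qed.

Lemma measurable_level : measurable_fun setT level.
Proof.
apply/(measurable_restrictT _ (measurable_itv _)).
by apply: subspace_continuous_measurable_fun => //; exact: res_H_continuous.
Qed.

Lemma level_sublevel a b : 0 <= a <= nu -> nup <= b <= 1 -> H a = H b ->
  level @^-1` `]-oo, H a] `&` `[0, 1] = `[a, b]%classic.
Proof.
move=> an nb ab; apply/seteqP; split=> v /=; rewrite !in_itv/=.
  by move=> [+ v01]; rewrite levelE// (res_H_sublevel meanF an nb ab).
move=> avb; have v01 : 0 <= v <= 1.
  case/andP: avb an nb => av vb /andP[a0 _] /andP[_ b1].
  by rewrite (le_trans a0)// (le_trans vb).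
by rewrite levelE// (res_H_sublevel meanF an nb ab).
Qed.

(** [res_K] is the length of the sublevel interval of [H], including the flat piece from [nu] to
    [nup] that carries the mass at [c]. *)
Lemma uniform01_level s : U01 (level @^-1` `]-oo, s]) = (res_K F s)%:E.
Proof.
have c0 := res_c_le0 meanF.
have n0 := res_nu_ge0 F; have nn := res_nu_le_nup F; have n1 := res_nup_le1 F.
rewrite uniform01E; last first.
  by rewrite -[X in measurable X]setTI; exact: measurable_level.
have itvE a b : 0 <= a <= nu -> nup <= b <= 1 -> H a = H b ->
    mu (level @^-1` `]-oo, H a] `&` `[0, 1]) = (b - a)%:E.
  move=> an nb ab; rewrite (level_sublevel an nb ab) lebesgue_measure_itv/= lte_fin.
  case: ltP => [//|ba]; rewrite (_ : a = b) ?subrr//; apply/le_anti.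
  rewrite ba (le_trans (andP an).2)// (le_trans nn)//.
  by case/andP: nb.
rewrite /res_K; have [s0|s0] := ltP 0 s.
  rewrite (_ : _ `&` _ = `[0, 1]%classic :> set R).
    by rewrite lebesgue_measure_itv/= lte_fin ltr01 sube0.
  apply/seteqP; split=> v /=; rewrite !in_itv/=; first by case.
  by move=> v01; split=> //; rewrite levelE// (le_trans (res_H_le0 meanF v01))// ltW.
have [cs|sc] := ltP c s.
  have cs0 : c < s <= 0 by rewrite cs.
  have [/andP[a0 an] Ha] := res_AP meanF cs0.
  have [/andP[nb b1] Hb] := res_BP meanF cs0.
  by rewrite -{1}Ha (itvE _ (res_B F s))// ?a0 ?b1 ?(ltW an) ?(ltW nb)// Ha Hb.
case: eqP => [->|/eqP sc'].
  by rewrite {1}/res_c (itvE nu nup)// ?n0 ?n1 ?lexx// -res_cE.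
rewrite (_ : _ `&` _ = set0) ?measure0//; apply/seteqP; split=> // v [] /=.
rewrite !in_itv/= => + v01; rewrite levelE// leNgt => /negP; apply.
by rewrite (lt_le_trans _ (res_H_ge_c meanF v01))// lt_neqAle sc' sc.
Qed.

Lemma integral_slope_sublevel s :
  \int[mu]_(t in level @^-1` `]-oo, s] `&` `[0, 1]) slope t = 0.
Proof.
have [s0|s0] := ltP 0 s.
  rewrite (_ : _ `&` _ = `[0, 1]%classic :> set R); first exact: integral_slope.
  apply/seteqP; split=> v /=; rewrite !in_itv/=; first by case.
  by move=> v01; split=> //; rewrite levelE// (le_trans (res_H_le0 meanF v01))// ltW.
have [cs|sc] := leP c s; last first.
  rewrite (_ : _ `&` _ = set0) ?Rintegral_set0//.
  apply/seteqP; split=> // v [] /=.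
  rewrite !in_itv/= => + v01; rewrite levelE// leNgt => /negP; apply.
  by rewrite (lt_le_trans _ (res_H_ge_c meanF v01)).
have cs0 : c <= s <= 0 by rewrite cs.
have [a an Ha] := res_A_exists meanF cs0.
have [b nb Hb] := res_B_exists meanF cs0.
have [/andP[a0 an'] /andP[nb' b1]] := (an, nb).
have ab : a <= b by rewrite (le_trans an')// (le_trans (res_nu_le_nup F)).
rewrite -{1}Ha (level_sublevel an nb) ?Ha ?Hb//.
transitivity (H b - H a); last by rewrite Ha Hb subrr.
have i1 (D : set R) : measurable D -> D `<=` `[0, 1] -> mu.-integrable D (EFin \o slope).
  by move=> mD sD; apply: integrableS (integrable_slope meanF).
rewrite res_H_sub// Rintegral_itv_bndo_bndc.
  rewrite Rintegral_itv_obnd_cbnd//; apply: i1 => //.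
  by apply: subset_itv; rewrite bnd_simp.
apply: i1 => //.
by apply: subset_itv; rewrite bnd_simp.
Qed.

Let up t : R := Num.max (slope t) 0.
Let down t : R := Num.max (- slope t) 0.

Lemma integral_up_down s :
  (\int[mu]_(t in level @^-1` `]-oo, s] `&` `[0%R, 1%R]) (up t)%:E =
   \int[mu]_(t in level @^-1` `]-oo, s] `&` `[0%R, 1%R]) (down t)%:E)%E.
Proof.
have := integral_slope_sublevel s; set D := _ `&` _ => I0.
have mD : measurable (D : set (measurableTypeR R)).
  apply: measurableI => //; rewrite -[X in measurable X]setTI.
  exact: measurable_level.
have iD : mu.-integrable D (EFin \o slope).
  by apply: integrableS (integrable_slope meanF) => // x [].
have : (\int[mu]_(t in D) (EFin \o slope) t = 0)%E.
  by rewrite -[LHS]fineK ?integrable_fin_num//; congr EFin.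
rewrite integralE => /eqP.
have fp := integrable_fin_num mD (integrable_funepos mD iD).
have fn := integrable_fin_num mD (integrable_funeneg mD iD).
rewrite sube_eq ?fin_num_adde_defl// add0e => /eqP e.
transitivity (\int[mu]_(x in D) ((EFin \o slope)^\+ x))%E.
  by apply: eq_integral => t _; rewrite funeposE /= EFin_max.
rewrite e; apply: eq_integral => t _.
by rewrite funenegE /= EFin_max EFinN.
Qed.

Let upr : R -> R := up \_ `[0, 1].
Let downr : R -> R := down \_ `[0, 1].

Let measurable_upr : measurable_fun setT (upr : measurableTypeR R -> R).
Proof.
apply/(measurable_restrictT _ (measurable_itv _)); apply: measurable_funTS.
by apply: measurable_maxr => //; exact: measurable_slope.
Qed.

Let measurable_downr : measurable_fun setT (downr : measurableTypeR R -> R).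
Proof.
apply/(measurable_restrictT _ (measurable_itv _)); apply: measurable_funTS.
apply: measurable_maxr => //; apply: measurable_funN; exact: measurable_slope.
Qed.

Let upr_ge0 t : 0 <= upr t.
Proof. by rewrite /upr patchE; case: ifP => // _; rewrite le_max lexx orbT. Qed.

Let downr_ge0 t : 0 <= downr t.
Proof. by rewrite /downr patchE; case: ifP => // _; rewrite le_max lexx orbT. Qed.

Let integral_restr (f g : R -> R) (E : set R) :
  (\int[mu]_(t in E) (f t * (g \_ `[0, 1]) t)%:E =
   \int[mu]_(t in E `&` `[0%R, 1%R]) (f t * g t)%:E)%E.
Proof.
rewrite integral_mkcondr; apply: eq_integral => t _.
by rewrite !patchE; case: ifP => //; rewrite mulr0.
Qed.

(* This says that the conditional mean of q(V) given H(V) is m. For f the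
   indicator of a ray it holds because {H <= s} is an interval [a, b] with
   H a = H b. *)
Lemma level_balance (f : R -> R) : measurable_fun setT f -> (forall s, 0 <= f s) ->
  (\int[mu]_(t in `[0%R, 1%R]) (f (level t) * up t)%:E =
   \int[mu]_(t in `[0%R, 1%R]) (f (level t) * down t)%:E)%E.
Proof.
move=> mf f0.
have ml : measurable_fun setT (level : measurableTypeR R -> measurableTypeR R).
  exact: measurable_level.
pose mup := mdensity mu measurable_upr upr_ge0.
pose mdown := mdensity mu measurable_downr downr_ge0.
pose pup : {measure set (measurableTypeR R) -> \bar R} :=
  measure_function_pushforward__canonical__measure_function_Measure mup ml.
pose pdown : {measure set (measurableTypeR R) -> \bar R} :=
  measure_function_pushforward__canonical__measure_function_Measure mdown ml.
have int1 (g : R -> R) (E : set R) : (\int[mu]_(t in E) ((g \_ `[0, 1]) t)%:E =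
    \int[mu]_(t in E `&` `[0%R, 1%R]) (g t)%:E)%E.
  under eq_integral do rewrite -[(_ \_ _) _]mul1r.
  by rewrite (integral_restr (cst 1)); apply: eq_integral => t _; rewrite mul1r.
have rays (s : R) : pup `]-oo, s]%classic = pdown `]-oo, s]%classic.
  rewrite /pup /pdown /= /pushforward /mdensity !int1; exact: integral_up_down.
have poo : (pup setT < +oo)%E.
  rewrite /pup /= /pushforward /mdensity preimage_setT int1 setTI.
  have /integrableP[_] := integrable_slope meanF; apply: le_lt_trans.
  apply: ge0_le_integral => //.
  - by move=> t _; rewrite lee_fin le_max lexx orbT.
  - apply/measurable_EFinP/measurable_funTS.
    by apply: measurable_maxr => //; exact: measurable_slope.
  - apply/measurable_funTS/measurableT_comp => //.
    by apply/measurable_EFinP; exact: measurable_slope.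
  - by move=> t _ /=; rewrite lee_fin ge_max normr_ge0 ler_norm.
have pE := measure_eq_rays poo rays.
have mEf : measurable_fun setT (fun s : measurableTypeR R => (f s)%:E).
  by apply/measurable_EFinP.
have key k (mk : measurable_fun setT (k : measurableTypeR R -> R)) (k0 : forall t, 0 <= k t) :
    (\int[pushforward (mdensity mu mk k0) (level : measurableTypeR R -> measurableTypeR R)]_s (f s)%:E =
     \int[mu]_t (f (level t) * k t)%:E)%E.
  rewrite (ge0_integral_pushforward ml)//; last by move=> s _; rewrite lee_fin.
  transitivity (\int[mdensity mu mk k0]_t (f (level t))%:E)%E; first by [].
  rewrite ge0_integral_mdensity.
  - by apply: eq_integral => t _; rewrite EFinM.
  - exact: (measurableT_comp mEf ml).
  - by move=> t; rewrite lee_fin.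
have -> : (\int[mu]_(t in `[0%R, 1%R]) (f (level t) * up t)%:E =
    \int[pup]_s (f s)%:E)%E.
  by rewrite [RHS]key (integral_restr (f \o level) up) setTI.
have -> : (\int[mu]_(t in `[0%R, 1%R]) (f (level t) * down t)%:E =
    \int[pdown]_s (f s)%:E)%E.
  by rewrite [RHS]key (integral_restr (f \o level) down) setTI.
by apply: eq_measure_integral => A mA _; exact: pE.
Qed.

End level_law.

(** * Increments of the integer part *)

Section rotation.
Context (R : realType).
Notation U01 := (uniform_prob (@ltr01 R)).
Notation mu := (@lebesgue_measure R).
Implicit Types x y p u : R.

Definition rfloor x : R := (Num.floor x)%:~R.

Lemma measurable_rfloor : measurable_fun setT rfloor.
Proof.
apply: nondecreasing_measurable => // x y xy.
by rewrite /rfloor ler_int; exact: le_floor.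
Qed.

Lemma rfloor_itv x : rfloor x <= x < rfloor x + 1.
Proof. by have := floor_itv x; rewrite intrD. Qed.

Lemma rfloorDfloor x y : rfloor (x + rfloor y) = rfloor x + rfloor y.
Proof. by rewrite /rfloor floorDrz ?intrD ?intrKfloor// intr_int. Qed.

Lemma rfloor_eq (n : int) x : n%:~R <= x < n%:~R + 1 -> rfloor x = n%:~R.
Proof. by move=> h; rewrite /rfloor (@floor_def _ _ n)// intrD. Qed.

(** For [p >= 0], the number of integers in the half-open interval from [u + y], excluded, to
    [u + y + p], included. *)
Definition jump y p u : R := rfloor (u + y + p) - rfloor (u + y).

Lemma measurable_jump y p : measurable_fun setT (jump y p).
Proof.
by apply: measurable_funB; apply: (measurableT_comp measurable_rfloor);
  do 2?apply: measurable_funD.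
Qed.

Lemma jump_bool y p u : 0 <= p <= 1 -> jump y p u = 0 \/ jump y p u = 1.
Proof.
move=> p01; rewrite /jump; have := rfloor_itv (u + y + p); have := rfloor_itv (u + y).
rewrite /rfloor; move: (Num.floor (u + y)) (Num.floor (u + y + p)) => m n hm hn.
have mn : m%:~R < (n + 1)%:~R :> R by rewrite intrD; lra.
have nm : n%:~R < (m + 2)%:~R :> R by rewrite intrD; lra.
move: mn nm; rewrite !ltr_int => mn nm.
have [->|->] : n = m \/ n = m + 1 by lia.
  by left; rewrite subrr.
by right; rewrite intrD addrAC subrr add0r.
Qed.

(** Rotating a uniform point of the circle keeps it uniform, so the shift [y] is irrelevant.
    Concretely, with z the fractional part of [y], the event is an interval of length [p] if z + p
    <= 1, and otherwise the complement of an interval of length [1 - p], up to endpoints. *)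
Lemma uniform01_jump y p : 0 <= p <= 1 -> U01 [set u | jump y p u = 1] = p%:E.
Proof.
move=> p01; pose z := y - rfloor y.
have z01 : 0 <= z < 1 by have := rfloor_itv y; rewrite /z; lra.
have jE u : jump y p u = rfloor (u + z + p) - rfloor (u + z).
  rewrite /jump (_ : u + y + p = u + z + p + rfloor y); last by rewrite /z; lra.
  rewrite (_ : u + y = u + z + rfloor y); last by rewrite /z; lra.
  by rewrite !rfloorDfloor; lra.
have mj x : measurable [set u | jump y p u = x].
  rewrite -[X in measurable X]setTI; exact: (measurable_jump y p measurableT (measurable_set1 x)).
have fl0 x : 0 <= x < 1 -> rfloor x = 0 by move=> h; apply: (@rfloor_eq 0); rewrite add0r.
have fl1 x : 1 <= x < 2 -> rfloor x = 1.
  by move=> h; apply: (@rfloor_eq 1); move: h => /andP[? ?]; apply/andP; split; lra.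
have fl2 x : 2 <= x < 3 -> rfloor x = 2.
  by move=> h; apply: (@rfloor_eq 2); move: h => /andP[? ?]; apply/andP; split; lra.
have [/andP[p0 p1] /andP[z0 z1]] := (p01, z01).
have n10 : (0 : R) <> 1 by apply/eqP; rewrite eq_sym oner_eq0.
have [zp|zp] := leP (z + p) 1.
  have jv u : 0 < u < 1 -> jump y p u = (1 - z - p <= u < 1 - z)%R%:R.
    move=> /andP[u0 u1]; rewrite jE.
    have [h1|h1] := leP (1 - z - p) u; have [h2|h2] := ltP u (1 - z) => /=.
    - by rewrite fl1 ?fl0 ?subr0//; apply/andP; split; lra.
    - by rewrite !fl1 ?subrr//; apply/andP; split; lra.
    - by rewrite !fl0 ?subrr//; apply/andP; split; lra.
    - lra.
  transitivity (U01 `[1 - z - p, 1 - z[).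
    rewrite (uniform01_oo (mj 1)) uniform01_oo//; congr mu.
    apply/seteqP; split=> u /= []; rewrite !in_itv/= => + u01; rewrite jv//.
      by case: (1 - z - p <= u < 1 - z) => // /n10.
    by case: (1 - z - p <= u < 1 - z).
  rewrite (uniform01_itv erefl) ?subr_ge0; [|lra..].
  by congr EFin; lra.
have jv u : 0 < u < 1 -> jump y p u = (~~ (1 - z <= u < 2 - z - p)%R)%:R.
  move=> /andP[u0 u1]; rewrite jE.
  have [h1|h1] := leP (1 - z) u; have [h2|h2] := ltP u (2 - z - p) => /=.
  - by rewrite !fl1 ?subrr//; apply/andP; split; lra.
  - rewrite fl2 ?fl1; [lra|apply/andP; split; lra..].
  - by rewrite fl1 ?fl0 ?subr0//; apply/andP; split; lra.
  - lra.
transitivity (U01 (~` `[1 - z, 2 - z - p[)).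
  rewrite (uniform01_oo (mj 1)) uniform01_oo//; last exact: measurableC.
  congr mu; apply/seteqP; split=> u /= []; rewrite !in_itv/= => + u01; rewrite jv//.
    by case: (1 - z <= u < 2 - z - p) => // /n10.
  by case: (1 - z <= u < 2 - z - p).
rewrite probability_setC//= (uniform01_itv erefl) ?subr_ge0; [|lra..].
by rewrite -EFinB; congr EFin; lra.
Qed.

Lemma uniform01_two_points lo hi y p x : lo <= hi -> 0 <= p <= 1 ->
  U01 [set u | lo + (hi - lo) * jump y p u <= x] =
  (p * (hi <= x)%R%:R + (1 - p) * (lo <= x)%R%:R)%:E.
Proof.
move=> lh p01.
have [hx|xh] := leP hi x.
  rewrite (_ : [set _ | _] = setT).
    by rewrite probability_setT (le_trans lh hx); rewrite /= ?mulr1 ?mulr0; congr EFin; lra.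
  apply/seteqP; split=> // u _ /=.
  by case: (jump_bool y u p01) => ->; lra.
have [lx|xl] := leP lo x.
  rewrite (_ : [set _ | _] = ~` [set u | jump y p u = 1]).
    rewrite probability_setC; last first.
      rewrite -[X in measurable X]setTI.
      exact: (measurable_jump y p measurableT (measurable_set1 1)).
    by rewrite /= uniform01_jump// -EFinB; rewrite /= ?mulr1 ?mulr0; congr EFin; lra.
  apply/seteqP; split=> u /=; last first.
    by case: (jump_bool y u p01) => -> //; lra.
  by move=> h j1; move: h; rewrite j1; lra.
rewrite (_ : [set _ | _] = set0) ?measure0; first by rewrite /= ?mulr1 ?mulr0; congr EFin; lra.
apply/seteqP; split=> // u /=.
by case: (jump_bool y u p01) => ->; lra.
Qed.

End rotation.

(** * The two-point mixture *)

Section two_point_mixture.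
Context (R : realType) (F : cumulativeBounded (0 : R) (1 : R)).
Hypothesis meanF : finite_mean F.
Notation mu := (@lebesgue_measure R).
Notation U01 := (uniform_prob (@ltr01 R)).
Notation H := (res_H F).
Notation nu := (res_nu F).
Notation nup := (res_nup F).
Notation c := (res_c F).
Notation slope := (slope F).
Notation level := (level F).

(** [low] and [high] are the deviations a - m and b - m. Level 0 is cut off because its points 0 and
    1 may have infinite quantiles; level [c] gets deviation 0, since q = m between [nu] and
    [nup]. *)
Definition low : R -> R := (slope \o res_A F) \_ `]c, 0[.
Definition high : R -> R := (slope \o res_B F) \_ `]c, 0[.
Definition gap s := high s - low s.

(* Off ]c, 0[ the gap is 0 and so is the weight, since x / 0 = 0. *)
Definition weight s := - low s / gap s.

Let A_itv s : c < s < 0 -> 0 < res_A F s < nu /\ H (res_A F s) = s.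
Proof.
move=> /andP[cs s0]; have [|/andP[a0 an] Ha] := res_AP meanF (s := s).
  by rewrite cs ltW.
split => //; rewrite an lt_neqAle a0 !andbT; apply/eqP => a0'.
by move: s0; rewrite -Ha -a0' res_H0 ltxx.
Qed.

Let B_itv s : c < s < 0 -> nup < res_B F s < 1 /\ H (res_B F s) = s.
Proof.
move=> /andP[cs s0]; have [|/andP[nb b1] Hb] := res_BP meanF (s := s).
  by rewrite cs ltW.
split => //; rewrite nb lt_neqAle b1 !andbT; apply/eqP => b1'.
by move: s0; rewrite -Hb b1' res_H1// ltxx.
Qed.

Let A01 s : c < s < 0 -> 0 < res_A F s < 1.
Proof.
move=> /A_itv[/andP[-> an] _] /=; apply: lt_le_trans an _.
exact: le_trans (res_nu_le_nup F) (res_nup_le1 F).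
Qed.

Let B01 s : c < s < 0 -> 0 < res_B F s < 1.
Proof.
move=> /B_itv[/andP[nb ->] _]; rewrite andbT; apply: le_lt_trans nb.
exact: le_trans (res_nu_ge0 F) (res_nu_le_nup F).
Qed.

Lemma lowE s : c < s < 0 -> low s = slope (res_A F s).
Proof. by move=> cs; rewrite /low patchE mem_set//= in_itv. Qed.

Lemma highE s : c < s < 0 -> high s = slope (res_B F s).
Proof. by move=> cs; rewrite /high patchE mem_set//= in_itv. Qed.

Lemma low_lt0 s : c < s < 0 -> low s < 0.
Proof.
by move=> cs; rewrite lowE//; apply: slope_lt0; [exact: A01|case/andP: (A_itv cs).1].
Qed.

Lemma high_gt0 s : c < s < 0 -> 0 < high s.
Proof.
by move=> cs; rewrite highE//; apply: slope_gt0; [exact: B01|case/andP: (B_itv cs).1].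
Qed.

Lemma low_out s : ~~ (c < s < 0) -> low s = 0.
Proof. by move=> cs; rewrite /low patchE memNset//= in_itv/=; exact/negP. Qed.

Lemma high_out s : ~~ (c < s < 0) -> high s = 0.
Proof. by move=> cs; rewrite /high patchE memNset//= in_itv/=; exact/negP. Qed.

Lemma low_le0 s : low s <= 0.
Proof. by have [/low_lt0/ltW//|/low_out->] := boolP (c < s < 0). Qed.

Lemma high_ge0 s : 0 <= high s.
Proof. by have [/high_gt0/ltW//|/high_out->] := boolP (c < s < 0). Qed.

Lemma weight01 s : 0 <= weight s <= 1.
Proof.
have := low_le0 s; have := high_ge0 s; rewrite /weight /gap => h0 l0.
have [->|lh] := eqVneq (high s - low s) 0; first by rewrite invr0 mulr0 lexx ler01.
have g0 : 0 < high s - low s by rewrite lt_neqAle eq_sym lh; lra.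
by rewrite divr_ge0 ?oppr_ge0 ?(ltW g0)//= ler_pdivrMr// mul1r; lra.
Qed.

(** This is the centring of the two-point law at level [s]. It survives a vanishing gap because
    [low] is then 0 as well. *)
Lemma weight_gap s : weight s * gap s = - low s.
Proof.
have [cs|cs] := boolP (c < s < 0).
  have := low_lt0 cs; have := high_gt0 cs => h0 l0.
  by rewrite /weight divfK// gt_eqF// /gap; lra.
by rewrite /weight low_out// oppr0 mul0r mul0r.
Qed.

Let H_inj_A a b : 0 <= a <= nu -> 0 <= b <= nu -> H a = H b -> a = b.
Proof.
move=> /andP[a0 an] /andP[b0 bn] ab; have [lt|lt|//] := ltgtP a b.
  by have := res_H_lt_decr meanF a0 lt bn; rewrite ab ltxx.
by have := res_H_lt_decr meanF b0 lt an; rewrite ab ltxx.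
Qed.

Let H_inj_B a b : nup <= a <= 1 -> nup <= b <= 1 -> H a = H b -> a = b.
Proof.
move=> /andP[a0 an] /andP[b0 bn] ab; have [lt|lt|//] := ltgtP a b.
  by have := res_H_lt_incr meanF a0 lt bn; rewrite ab ltxx.
by have := res_H_lt_incr meanF b0 lt an; rewrite ab ltxx.
Qed.

(** On the left branch [H] is injective, so [res_A] recovers [v] from its level; [level_right] is
    the mirror image with [res_B]. *)
Lemma level_left v : 0 < v < nu -> c < level v < 0 /\ low (level v) = slope v.
Proof.
move=> /andP[v0 vn].
have v1 := lt_le_trans vn (le_trans (res_nu_le_nup F) (res_nup_le1 F)).
rewrite levelE ?(ltW v0) ?(ltW v1)//.
have cH : c < H v < 0.
  have := res_H_lt_decr meanF (lexx 0) v0 (ltW vn); rewrite res_H0 => ->.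
  by rewrite (res_H_lt_decr meanF (ltW v0) vn).
split=> //; rewrite lowE//; congr slope.
have [/andP[a0 an] Ha] := A_itv cH.
by apply: H_inj_A; rewrite ?(ltW v0) ?(ltW vn) ?(ltW a0) ?(ltW an).
Qed.

Lemma level_right v : nup < v < 1 -> c < level v < 0 /\ high (level v) = slope v.
Proof.
move=> /andP[nv v1].
have v0 := le_lt_trans (le_trans (res_nu_ge0 F) (res_nu_le_nup F)) nv.
rewrite levelE ?(ltW v0) ?(ltW v1)//.
have cH : c < H v < 0.
  have := res_H_lt_incr meanF (ltW nv) v1 (lexx 1); rewrite res_H1// => ->.
  by rewrite res_cE// (res_H_lt_incr meanF (lexx _) nv (ltW v1)).
split=> //; rewrite highE//; congr slope.
have [/andP[nb b1] Hb] := B_itv cH.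
by apply: H_inj_B; rewrite ?(ltW nv) ?(ltW v1) ?(ltW nb) ?(ltW b1).
Qed.

Lemma level_flat v : 0 < v < 1 -> nu <= v <= nup -> level v = c.
Proof.
move=> /andP[v0 v1] /andP[nv vn]; rewrite levelE ?(ltW v0) ?(ltW v1)//.
by rewrite (@res_H_flat R F meanF v nup)// res_cE.
Qed.

Lemma res_nup_gt0 : 0 < nup.
Proof.
rewrite lt_neqAle (le_trans (res_nu_ge0 F) (res_nu_le_nup F)) andbT.
apply/eqP => n0; have : H 0 < H 1 by apply: res_H_lt_incr => //; rewrite -n0.
by rewrite res_H0 res_H1// ltxx.
Qed.

Lemma res_width_level v : 0 < v < 1 -> res_width F (level v) = (gap (level v))%:E.
Proof.
move=> v01; have v01' : 0 <= v <= 1 by case/andP: v01 => /ltW-> /ltW->.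
have lc : c <= level v by rewrite levelE// res_H_ge_c.
move: lc; rewrite le_eqVlt => /predU1P[<-|cl].
  (* At level [c] both points are [res_nup] and the width is a quantile minus itself. It is 0
     because that quantile is finite: above -oo by [res_nup_gt0], and at most the mean. *)
  rewrite /gap low_out ?high_out ?ltxx// subr0 /res_width /res_A /res_B ltxx/=.
  rewrite subee// fin_numElt quantile_gtNy ?res_nup_gt0//=.
  apply: (@le_lt_trans _ _ (mean F)%:E); last exact: ltry.
  by rewrite quantile_le ?res_nup_gt0.
have c0 : c < 0.
  by apply: lt_le_trans cl _; rewrite levelE// res_H_le0.
have l0 : c < level v < 0 by rewrite cl levelE// (res_H_lt0 meanF c0 v01).
rewrite /res_width !rquantileE ?A01 ?B01// -EFinB /gap lowE// highE//.
by rewrite opprB addrA subrK.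
Qed.

Lemma measurable_low : measurable_fun setT low.
Proof.
apply/(measurable_restrictT _ (measurable_itv _)).
apply: nonincreasing_itv_measurable; first exact: interval_is_interval.
move=> x y; rewrite !inE/= !in_itv/= => xI yI xy; rewrite lerD2r.
have [/andP[ax0 axn] Hx] := A_itv xI; have [/andP[ay0 ayn] Hy] := A_itv yI.
apply: rquantile_nondecreasing; rewrite ?in_itv/= ?A01//.
rewrite leNgt; apply/negP => lt.
have := res_H_lt_decr meanF (ltW ay0) lt (ltW axn).
by rewrite Hx Hy ltNge xy.
Qed.

Lemma measurable_high : measurable_fun setT high.
Proof.
apply/(measurable_restrictT _ (measurable_itv _)).
apply: nondecreasing_itv_measurable; first exact: interval_is_interval.
move=> x y; rewrite !inE/= !in_itv/= => xI yI xy; rewrite lerD2r.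
have [/andP[nbx bx1] Hx] := B_itv xI; have [/andP[nby by1] Hy] := B_itv yI.
apply: rquantile_nondecreasing; rewrite ?in_itv/= ?B01//.
rewrite leNgt; apply/negP => lt.
have := res_H_lt_incr meanF (ltW nby) lt (ltW bx1).
by rewrite Hx Hy ltNge xy.
Qed.

Lemma measurable_gap : measurable_fun setT gap.
Proof. by apply: measurable_funB; [exact: measurable_high|exact: measurable_low]. Qed.

Lemma gap_ge0 s : 0 <= gap s.
Proof. by rewrite subr_ge0 (le_trans (low_le0 s)) ?high_ge0. Qed.

Lemma measurable_gapV : measurable_fun setT (fun s => (gap s)^-1).
Proof.
rewrite (_ : (fun s => _) = (fun s => gap s `^ (-1))); last first.
  by apply/funext => s; rewrite powR_inv1// gap_ge0.
exact: (measurableT_comp (measurable_powR (-1)) measurable_gap).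
Qed.

Lemma measurable_weight : measurable_fun setT weight.
Proof.
apply: measurable_funM; last exact: measurable_gapV.
by apply: measurable_funN; exact: measurable_low.
Qed.

Let ind (f : R -> R) (x s : R) : R := (mean F + f s <= x)%R%:R.

Let measurable_ind f x : measurable_fun setT f -> measurable_fun setT (ind f x).
Proof.
move=> mf.
have mb : measurable_fun setT (fun s => mean F + f s <= x).
  by apply: measurable_fun_ler => //; exact: measurable_funD.
exact: (measurableT_comp (f := fun b : bool => (b%:R : R)) _ mb).
Qed.

Let ind_ge0 f x s : 0 <= ind f x s. Proof. by rewrite /ind. Qed.

Let ind_le1 f x s : ind f x s <= 1. Proof. by rewrite /ind lern1 leq_b1. Qed.

(** The conditional distribution function at [x] of the two-point variable, given level [s]. *)
Definition mixture x s : R := weight s * ind high x s + (1 - weight s) * ind low x s.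

(** Dividing by the gap here leaves [down] or [up] as the only factor that is not a function of the
    level, which is the form that [level_balance] takes. *)
Let phi f x s : R := ind f x s / gap s.

Let measurable_phi f x : measurable_fun setT f -> measurable_fun setT (phi f x).
Proof.
by move=> mf; apply: measurable_funM; [exact: measurable_ind|exact: measurable_gapV].
Qed.

Let phi_ge0 f x s : 0 <= phi f x s.
Proof. by rewrite divr_ge0// gap_ge0. Qed.

Let up t : R := Num.max (slope t) 0.
Let down t : R := Num.max (- slope t) 0.

(* The subtracted terms are moved to the other side so that all summands are
   nonnegative; the brackets on both sides have the same integral. *)
Let mixture_identity x v : 0 < v < 1 -> v != nu ->
  mixture x (level v) +
    (phi low x (level v) * down v + phi high x (level v) * up v) =
  (rquantile F v <= x)%R%:R +
    (phi high x (level v) * down v + phi low x (level v) * up v).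
Proof.
move=> v01 vn; have [v0 v1] := andP v01.
have qE : rquantile F v = mean F + slope v by rewrite addrC subrK.
have [lt|gt|/eqP] := ltgtP v nu; last by rewrite (negbTE vn).
  have [cl lE] := level_left (introT andP (conj v0 lt)).
  have l0 := low_lt0 cl; have h0 := high_gt0 cl.
  have g0 : gap (level v) != 0 by rewrite gt_eqF// /gap; lra.
  have -> : up v = 0 by apply: max_r; rewrite -lE ltW.
  have -> : down v = - low (level v) by rewrite lE; apply: max_l; rewrite -lE; lra.
  rewrite /mixture /phi /weight qE -lE -/(ind low x (level v)).
  by field.
have [vn'|nv] := leP v nup.
  have sl : slope v = 0 by apply: slope_eq0.
  have lc : level v = c by apply: level_flat; rewrite // (ltW gt).
  have -> : up v = 0 by rewrite /up sl maxxx.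
  have -> : down v = 0 by rewrite /down sl oppr0 maxxx.
  rewrite !mulr0 !addr0 lc qE sl /mixture /weight /ind.
  rewrite low_out ?high_out ?ltxx// oppr0 mul0r mul0r add0r subr0 mul1r.
  by [].
have [cl hE] := level_right (introT andP (conj nv v1)).
have l0 := low_lt0 cl; have h0 := high_gt0 cl.
have g0 : gap (level v) != 0 by rewrite gt_eqF// /gap; lra.
have -> : up v = high (level v) by rewrite hE; apply: max_l; rewrite -hE ltW.
have -> : down v = 0 by apply: max_r; rewrite -hE; lra.
rewrite /mixture /phi /weight qE -hE -/(ind high x (level v)).
move: g0; rewrite /gap => g0.
by field.
Qed.

Let gap_level v : 0 <= v <= 1 ->
  gap (level v) = 0 \/ up v <= gap (level v) /\ down v <= gap (level v).
Proof.
move=> v01; have [cl|cl] := boolP (c < level v < 0); last first.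
  by left; rewrite /gap low_out ?high_out// subr0.
right; have l0 := low_lt0 cl; have h0 := high_gt0 cl.
have v0 : 0 < v.
  rewrite lt_neqAle (andP v01).1 andbT; apply/eqP => v0.
  by move: cl; rewrite levelE// -v0 res_H0 ltxx andbF.
have v1 : v < 1.
  rewrite lt_neqAle (andP v01).2 andbT; apply/eqP => v1.
  by move: cl; rewrite levelE// v1 res_H1// ltxx andbF.
have v01' : 0 < v < 1 by rewrite v0.
have [lt|nv] := ltP v nu.
  have [_ lE] := level_left (introT andP (conj v0 lt)).
  by split; rewrite ge_max gap_ge0 andbT -lE /gap; lra.
have [vn'|nv'] := leP v nup.
  by move: cl; rewrite (level_flat v01') ?nv// ltxx.
have [_ hE] := level_right (introT andP (conj nv' v1)).
by split; rewrite ge_max gap_ge0 andbT -hE /gap; lra.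
Qed.

Let measurable_up : measurable_fun setT up.
Proof. by apply: measurable_maxr => //; exact: measurable_slope. Qed.

Let measurable_down : measurable_fun setT down.
Proof.
by apply: measurable_maxr => //; apply: measurable_funN; exact: measurable_slope.
Qed.

Let up_ge0 t : 0 <= up t. Proof. by rewrite le_max lexx orbT. Qed.
Let down_ge0 t : 0 <= down t. Proof. by rewrite le_max lexx orbT. Qed.

Let measurable_level_comp (f : R -> R) : measurable_fun setT f ->
  measurable_fun setT (f \o level).
Proof. by move=> mf; apply: measurableT_comp => //; exact: measurable_level. Qed.

(** The integrand is at most 1: the indicator is, and [g] is at most the gap that divides it; a zero
    gap makes the quotient 0. Finiteness allows the integral to be cancelled later. *)
Let integral_fin (f g : R -> R) x : measurable_fun setT f -> measurable_fun setT g ->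
  (forall t, 0 <= g t) ->
  (forall v, 0 <= v <= 1 -> gap (level v) = 0 \/ g v <= gap (level v)) ->
  (\int[mu]_(t in `[0%R, 1%R]) (phi f x (level t) * g t)%:E)%E \is a fin_num.
Proof.
move=> mf mg g0 gg; rewrite ge0_fin_numE; last first.
  by apply: integral_ge0 => t _; rewrite lee_fin mulr_ge0.
apply: (@le_lt_trans _ _ (\int[mu]_(t in `[0%R, 1%R]) (cst 1 t))%E); last first.
  by rewrite integral_cst//= lebesgue_measure_itv/= lte_fin ltr01 sube0 mule1 ltry.
apply: ge0_le_integral => //.
- by move=> t _; rewrite lee_fin mulr_ge0.
- apply/measurable_EFinP/measurable_funTS/measurable_funM => //.
  by apply: measurable_level_comp; exact: measurable_phi.
move=> v /=; rewrite in_itv/= => v01; rewrite lee_fin.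
have [g00|gle] := gg v v01; first by rewrite /phi g00 invr0 mulr0 mul0r ler01.
have := gap_ge0 (level v); rewrite le_eqVlt => /predU1P[g00|gp].
  by rewrite /phi -g00 invr0 mulr0 mul0r ler01.
rewrite /phi -mulrA mulrC -mulrA ler_pdivrMl// mulr1.
by apply: le_trans gle; rewrite ler_piMr// g0.
Qed.

Lemma integral_mixture x : (\int[U01]_v (mixture x (level v))%:E = (F x)%:E)%E.
Proof.
have mm : measurable_fun setT (mixture x).
  apply: measurable_funD; apply: measurable_funM.
  - exact: measurable_weight.
  - exact: measurable_ind measurable_high.
  - by apply: measurable_funB => //; exact: measurable_weight.
  - exact: measurable_ind measurable_low.
have m0 s : 0 <= mixture x s.
  by have /andP[w0 w1] := weight01 s; rewrite addr_ge0// mulr_ge0// subr_ge0.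
have U01E (f : R -> R) : measurable_fun setT f -> (forall v, 0 <= f v) ->
    (\int[U01]_v (f v)%:E = \int[mu]_(v in `[0%R, 1%R]) (f v)%:E)%E.
  move=> mf f0; rewrite integral_uniform ?subr0 ?invr1 ?mul1e//.
  exact/measurable_EFinP.
rewrite (U01E (mixture x \o level)); [|exact: measurable_level_comp mm|by move=> v; exact: m0].
pose S := rquantile F @^-1` `]-oo, x].
pose iS : R -> R := \1_S.
have mS : measurable S.
  by rewrite -[X in measurable X]setTI; exact: measurable_rquantile.
have FE : (\int[mu]_(v in `[0%R, 1%R]) (iS v)%:E = (F x)%:E)%E.
  rewrite -U01E; [|exact: measurable_indic|by move=> v; rewrite /iS indicE].
  rewrite integral_indic// setIT [LHS]law_rquantile//.
  exact: cdf_lebesgue_stieltjes_id.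
have mphi f g : measurable_fun setT f -> measurable_fun setT g ->
    measurable_fun (`[0, 1]%classic : set (measurableTypeR R)) (fun v => (phi f x (level v) * g v)%:E).
  move=> mf mg; apply/measurable_EFinP/measurable_funTS/measurable_funM => //.
  by apply: measurable_level_comp; exact: measurable_phi.
have ml := measurable_low; have mh := measurable_high.
have phig0 f g v : 0 <= g v -> (0 <= (phi f x (level v) * g v)%:E)%E.
  by move=> g0; rewrite lee_fin mulr_ge0.
have mmix : measurable_fun (`[0, 1]%classic : set (measurableTypeR R)) (fun v => (mixture x (level v))%:E).
  by apply/measurable_EFinP/measurable_funTS; exact: measurable_level_comp mm.
have mind : measurable_fun (`[0, 1]%classic : set (measurableTypeR R)) (fun v => (iS v)%:E).
  by apply/measurable_EFinP/measurable_funTS; exact: measurable_indic.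
pose I (f : R -> R) := (\int[mu]_(v in `[0%R, 1%R]) (f v)%:E)%E.
pose M v := mixture x (level v).
pose a v := phi low x (level v) * down v.
pose b v := phi high x (level v) * up v.
pose a' v := phi low x (level v) * up v.
pose b' v := phi high x (level v) * down v.
have split3 (f g h : R -> R) :
    measurable_fun (`[0, 1]%classic : set (measurableTypeR R)) (fun v => (f v)%:E) ->
    measurable_fun (`[0, 1]%classic : set (measurableTypeR R)) (fun v => (g v)%:E) ->
    measurable_fun (`[0, 1]%classic : set (measurableTypeR R)) (fun v => (h v)%:E) ->
    (forall v, 0 <= f v) -> (forall v, 0 <= g v) -> (forall v, 0 <= h v) ->
    (I f + (I g + I h) = I (fun v => f v + (g v + h v))%R)%E.
  move=> mf mg mh' f0 g0 h0; rewrite /I -ge0_integralD//.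
  rewrite -ge0_integralD//.
  - by move=> v _; rewrite lee_fin.
  - by move=> v _; rewrite -EFinD lee_fin addr_ge0.
  - exact: emeasurable_funD.
  - by move=> v _; rewrite lee_fin.
  - by move=> v _; rewrite lee_fin.
have [ma0 mb0 ma'0 mb'0] : [/\ forall v, 0 <= a v, forall v, 0 <= b v,
    forall v, 0 <= a' v & forall v, 0 <= b' v].
  by split => v; exact: mulr_ge0.
have iS0 v : 0 <= iS v by rewrite /iS indicE.
have M0 v : 0 <= M v by exact: m0.
have [[[ma mb] ma'] mb'] := (mphi _ _ ml measurable_down, mphi _ _ mh measurable_up,
  mphi _ _ ml measurable_up, mphi _ _ mh measurable_down).
have sum_m (f1 f2 f3 : R -> R) :
    measurable_fun (`[0, 1]%classic : set (measurableTypeR R)) (fun v => (f1 v)%:E) ->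
    measurable_fun (`[0, 1]%classic : set (measurableTypeR R)) (fun v => (f2 v)%:E) ->
    measurable_fun (`[0, 1]%classic : set (measurableTypeR R)) (fun v => (f3 v)%:E) ->
    measurable_fun (`[0, 1]%classic : set (measurableTypeR R))
      (fun v => (f1 v + (f2 v + f3 v))%R%:E).
  move=> /measurable_EFinP mf1 /measurable_EFinP mf2 /measurable_EFinP mf3.
  by apply/measurable_EFinP; apply: measurable_funD => //; exact: measurable_funD.
have key : (I M + (I a + I b) = I iS + (I b' + I a'))%E.
  rewrite (split3 M a b mmix ma mb M0 ma0 mb0).
  rewrite (split3 iS b' a' mind mb' ma' iS0 mb'0 ma'0).
  apply: ge0_ae_eq_integral.
  - exact: measurable_itv.
  - exact: sum_m mmix ma mb.
  - exact: sum_m mind mb' ma'.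
  - by move=> v _; rewrite lee_fin; exact: addr_ge0 (M0 v) (addr_ge0 (ma0 v) (mb0 v)).
  - by move=> v _; rewrite lee_fin; exact: addr_ge0 (iS0 v) (addr_ge0 (mb'0 v) (ma'0 v)).
  (* At [nu] the identity can fail: the quantile there may lie below the mean although the level is
     already [c]. *)
  exists [set 0; 1; nu]; split.
  - by apply: measurableU => //; exact: measurableU.
  - by apply: countable_lebesgue_measure0; apply: finite_set_countable.
  move=> v /= nid; apply: contrapT => nv; apply: nid; rewrite in_itv/= => v01.
  have [v_0 [v_1 v_nu]] : v != 0 /\ v != 1 /\ v != nu.
    by split; [|split]; apply/eqP => ve; apply: nv; rewrite ve; [left; left|left; right|right].
  have v01' : 0 < v < 1.
    by case/andP: v01 => v0 v1; rewrite lt_neqAle eq_sym v_0 v0 lt_neqAle v_1.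
  congr EFin; rewrite mixture_identity//; congr (_ + _).
  rewrite /iS indicE; congr (_%:R); congr nat_of_bool; apply/idP/idP => [h|/set_mem].
    by apply: mem_set; rewrite /S/= in_itv.
  by rewrite /S/= in_itv.
(* By balance both brackets of [key] become [I a + I b'], which is finite and cancels. *)
have aa' : I a' = I a.
  exact: (level_balance meanF (measurable_phi x ml) (phi_ge0 low x)).
have bb' : I b = I b'.
  exact: (level_balance meanF (measurable_phi x mh) (phi_ge0 high x)).
have gd v : 0 <= v <= 1 -> gap (level v) = 0 \/ down v <= gap (level v).
  by move=> /gap_level[?|[_ ?]]; [left|right].
have fa : I a \is a fin_num by exact: integral_fin ml measurable_down down_ge0 gd.
have fb : I b' \is a fin_num by exact: integral_fin mh measurable_down down_ge0 gd.
move: key; rewrite aa' bb' [X in (_ = _ + X)%E]addeC => key.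
rewrite -FE; change (I M = I iS).
move: (I M) (I iS) (I a) (I b') fa fb key => p q r t fr ft key.
have frt : (r + t)%E \is a fin_num by rewrite fin_numD fr ft.
by rewrite -[p](addeK _ frt) key addeK.
Qed.

End two_point_mixture.

(** * The summands and their partial sums *)

Section steps.
Context (R : realType) (F : cumulativeBounded (0 : R) (1 : R)).
Hypothesis meanF : finite_mean F.
Notation U01 := (uniform_prob (@ltr01 R)).
Notation low := (low F).
Notation high := (high F).
Notation gap := (gap F).
Notation weight := (weight F).
Notation level := (level F).

(** Takes the value a when the jump is 0 and b when it is 1; the form affine in the jump lets
    partial sums telescope. *)
Definition step (i : nat) (s u : R) : R :=
  mean F + low s + gap s * jump (i%:R * weight s) (weight s) u.

Lemma measurable_step i : measurable_fun setT (fun z : R * R => step i z.1 z.2).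
Proof.
have m1 (f : R -> R) : measurable_fun setT f ->
    measurable_fun setT (fun z : R * R => f z.1).
  by move=> mf; apply: measurableT_comp.
have mlow := m1 _ (measurable_low meanF).
have mgap := m1 _ (measurable_gap meanF).
have mw := m1 _ (measurable_weight meanF).
have mz : measurable_fun setT (fun z : R * R => z.2 + i%:R * weight z.1).
  by apply: measurable_funD => //; exact: measurable_funM.
apply: measurable_funD; first exact: measurable_funD.
apply: measurable_funM => //; apply: measurable_funB.
  apply: (measurableT_comp (@measurable_rfloor R)).
  exact: measurable_funD.
exact: (measurableT_comp (@measurable_rfloor R)).
Qed.

(** After telescoping, [weight_gap] absorbs the drift [n low], and what remains is the gap times the
    fractional part of [u] minus that of [u + n p]. *)
Lemma sum_step_bound n s u :
  `|\sum_(i < n) step i s u - n%:R * mean F| <= gap s.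
Proof.
set p := weight s.
have -> : \sum_(i < n) step i s u =
    n%:R * (mean F + low s) + gap s * (rfloor (u + n%:R * p) - rfloor u).
  elim: n => [|n IH]; first by rewrite big_ord0 !mul0r addr0 subrr mulr0 addr0.
  rewrite big_ord_recr/= IH /step /jump -/p.
  rewrite (_ : u + n.+1%:R * p = u + n%:R * p + p); last by rewrite -natr1; ring.
  by rewrite -natr1; ring.
have lE : low s = - (p * gap s) by rewrite weight_gap// opprK.
rewrite lE (_ : _ - _ = gap s * (rfloor (u + n%:R * p) - rfloor u - n%:R * p)); last by ring.
rewrite normrM (ger0_norm (gap_ge0 meanF s)) ler_piMr ?gap_ge0// ler_norml.
have := rfloor_itv (u + n%:R * p); have := rfloor_itv u.
by move=> /andP[? ?] /andP[? ?]; apply/andP; split; lra.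
Qed.

Lemma prob_step i x :
  (U01 \x U01)%E [set z | step i (level z.1) z.2 <= x] = (F x)%:E.
Proof.
(* The product measure integrates the probabilities of sections, so it suffices to match the section
   at [v] with the mixture at [level v], whatever [i] is. *)
rewrite -(integral_mixture meanF); apply: eq_integral => v _.
transitivity (U01 [set u | (mean F + low (level v)) +
    ((mean F + high (level v)) - (mean F + low (level v))) *
    jump (i%:R * weight (level v)) (weight (level v)) u <= x]).
  rewrite (_ : _ - _ = gap (level v)); last by rewrite /gap; ring.
  by congr (U01 _); apply/seteqP; split=> u /=; [move=> /xsectionP|move=> ?; apply/xsectionP].
by rewrite uniform01_two_points ?weight01// lerD2l (le_trans (low_le0 meanF _))// high_ge0.
Qed.

End steps.

(** * Realisation on the given probability space *)

Theorem theorem2p1 (R : realType) (d : measure_display) (T : measurableType d)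
    (P : probability T R) (F : cumulativeBounded (0 : R) (1 : R)) :
  atomless P ->
  finite_mean F ->
  exists (X : nat -> {RV P >-> R}) (Z : {RV P >-> R}),
    [/\ forall i x, cdf (X i) x = (F x)%:E,
        residual_distribution F P (cdf Z) &
        forall n : nat, (0 < n)%N ->
          {ae P, forall w,
            `|\sum_(i < n) X i w - n%:R * mean F| <= Z w}].
Proof.
move=> aP meanF; have [V [W [V01 VW]]] := atomless_uniform_pair_oo aP.
have mY : measurable_fun setT (level F \o V).
  by apply: measurableT_comp => //; exact: measurable_level.
pose Y : {RV P >-> R} := HB.pack (level F \o V) (isMeasurableFun.Build _ _ _ _ _ mY).
have mZ : measurable_fun setT (gap F \o Y).
  by apply: measurableT_comp => //; exact: measurable_gap.
pose Z : {RV P >-> R} := HB.pack (gap F \o Y) (isMeasurableFun.Build _ _ _ _ _ mZ).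
have mX i : measurable_fun setT (fun w => step F i (Y w) (W w)).
  have mYW : measurable_fun setT (fun w => (Y w, W w)) by exact: measurable_fun_pair.
  exact: (measurableT_comp (measurable_step meanF i) mYW).
pose X i : {RV P >-> R} :=
  HB.pack (fun w => step F i (Y w) (W w)) (isMeasurableFun.Build _ _ _ _ _ (mX i)).
have mlevel (E : set (R * R)) : measurable E ->
    measurable [set z : R * R | E (level F z.1, z.2)].
  move=> mE.
  have ml : measurable_fun setT (fun z : R * R => (level F z.1, z.2)).
    apply: measurable_fun_pair => //; apply: measurableT_comp => //.
    exact: measurable_level.
  by rewrite -[X in measurable X]setTI; exact: ml.
exists X, Z; split.
- move=> i x; rewrite -(prob_step meanF i x) -VW.
    by congr (P _); apply/seteqP; split=> w /=; rewrite in_itv.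
  apply: (mlevel [set z | step F i z.1 z.2 <= x]).
  rewrite (_ : [set _ | _] = (fun z => step F i z.1 z.2) @^-1` `]-oo, x]).
    by rewrite -[X in measurable X]setTI; exact: measurable_step.
  by apply/seteqP; split=> z /=; rewrite in_itv.
(* This holds at every outcome, not only almost surely, because [V] never takes the values 0 and
   1. *)
- have wE w : res_width F (Y w) = (Z w)%:E by exact: res_width_level.
  exists Y; split.
  + move=> s; rewrite -(uniform01_level meanF s).
    have mE : measurable (level F @^-1` `]-oo, s]).
      by rewrite -[X in measurable X]setTI; exact: measurable_level.
    transitivity (P [set w | ((level F @^-1` `]-oo, s]) `*` setT) (V w, W w)]).
      by congr (P _); apply/seteqP; split=> w //= [].
    rewrite VW; last exact: measurableX.
    by rewrite product_measure1E// [X in (_ * X)%E]probability_setT mule1.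
  + apply: eq_measurable_fun (fun w _ => esym (wE w)) _.
    exact/measurable_EFinP.
  + move=> x; congr (P _); apply/seteqP; split=> w /=; rewrite in_itv/= wE lee_fin//.
- by move=> n _; apply: aeW => w; exact: sum_step_bound.
Qed.
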